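(* Let $d\ge 4$ and let $\Delta$ be a balanced normal $(d-1)$-pseudomanifold. If all vertex links of $\Delta$ are stacked cross-polytopal spheres and $\Delta$ has no missing $(d-2)$-faces, then $\Delta$ belongs to the balanced Walkup class $\mathcal{BH}^d$.
   Context: Balanced: proper $d$-coloring of the vertices, no face containing two vertices of the same color. Normal $(d-1)$-pseudomanifold: connected, pure, each $(d-2)$-face in exactly two facets, links of faces of dimension $\le d-3$ connected. A missing face is a non-face all of whose proper subsets are faces; its dimension is its size minus one. $\mathcal{C}^*_k$ is the boundary complex of the $k$-dimensional cross-polytope (the $k$-fold join of $\mathbb{S}^0$, the $i$-th copy colored $i$). Balanced connected sum: identify a facet of one balanced complex with a facet of another (disjoint) balanced complex of the same dimension via a color-preserving bijection and delete the identified facet; a stacked cross-polytopal sphere is a balanced connected sum of one or more copies of $\mathcal{C}^*_k$. Balanced handle addition: given disjoint facets $F,F'$ of a balanced pure complex and a color-preserving bijection $\varphi:F\to F'$ such that $v$ and $\varphi(v)$ have no common neighbor for all $v\in F$, identify $v$ with $\varphi(v)$ and delete the identified facet. The balanced Walkup class $\mathcal{BH}^d$ consists of the balanced $(d-1)$-dimensional complexes obtained from copies of $\mathcal{C}^*_d$ by successively applying balanced connected sums and balanced handle additions. *)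

(* Defs.v *)
From HB Require Import structures.
From mathcomp Require Import all_boot.

Set Implicit Arguments.
Unset Strict Implicit.
Unset Printing Implicit Defensive.

(* A finite abstract simplicial complex is given by its set of faces, including
   the empty face.  Elements of T that lie in no face are allowed and are not
   vertices of the complex, so that a link or a quotient of a complex can live
   on the same ambient type. *)
Section Complexes.
Variable T : finType.
Implicit Types (K : {set {set T}}) (F G M : {set T}) (u v w : T).

Definition simplicial_complex K : Prop :=
  set0 \in K /\ (forall F G, F \in K -> G \subset F -> G \in K).

Definition vertices K : {set T} := [set v | [set v] \in K].

Definition facet K F : bool := maxset [in K] F.

Definition link K F : {set {set T}} :=
  [set G : {set T} | [disjoint G & F] && (G :|: F \in K)].

Definition adjacent K : rel T :=
  [rel u v | (u != v) && ([set u; v] \in K)].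

Definition connected_complex K : Prop :=
  {in vertices K &, forall u v, connect (adjacent K) u v}.

(* A face of dimension e has e + 1 elements: facets have d elements,
   (d-2)-faces have d - 1, and faces of dimension <= d - 3 at most d - 2. *)
Definition normal_pseudomanifold (d : nat) K : Prop :=
  [/\ connected_complex K,
      forall F, facet K F -> #|F| = d,
      forall G, G \in K -> #|G| = d.-1 ->
        #|[set F : {set T} | facet K F && (G \subset F)]| = 2
    & forall G, G \in K -> #|G| <= d - 2 -> connected_complex (link K G)].

Definition missing_face K M : Prop :=
  [/\ M \subset vertices K, M \notin K & forall G, G \proper M -> G \in K].

End Complexes.

Record colored_complex (k : nat) := ColoredComplex {
  vert : finType;
  faces : {set {set vert}};
  color : vert -> 'I_k
}.

Definition balanced (k : nat) (K : colored_complex k) : Prop :=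
  forall F, F \in faces K -> {in F &, injective (color (c := K))}.

Definition colored_iso (k : nat) (K L : colored_complex k) : Prop :=
  exists f : vert K -> vert L,
    [/\ {in vertices (faces K) &, injective f},
        faces L = [set f @: F | F : {set vert K} in faces K]
      & {in vertices (faces K), forall v, color (f v) = color v}].

(* The k-fold join of the 0-spheres {(i, true), (i, false)}. *)
Definition cross_polytope (k : nat) : colored_complex k :=
  @ColoredComplex k ('I_k * bool)%type
    [set F : {set 'I_k * bool} |
      [forall i, ~~ (((i, true) \in F) && ((i, false) \in F))]]
    fst.

Definition disjoint_union (k : nat) (K L : colored_complex k) :
    colored_complex k :=
  @ColoredComplex k (vert K + vert L)%type
    ([set inl @: F | F : {set vert K} in faces K] :|:
     [set inr @: F | F : {set vert L} in faces L])
    (fun x => match x with inl v => color v | inr w => color w end).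

Definition color_bijection (k : nat) (K L : colored_complex k)
    (F : {set vert K}) (F' : {set vert L}) (phi : vert K -> vert L) : Prop :=
  [/\ {in F &, injective phi}, phi @: F = F'
    & {in F, forall v, color (phi v) = color v}].

(* Every v in F is identified with phi v, which represents the class {v, phi v}
   (so v itself is no longer a vertex), and the image of F is deleted. *)
Definition identify (k : nat) (K : colored_complex k) (F : {set vert K})
    (phi : vert K -> vert K) : colored_complex k :=
  let q v := if v \in F then phi v else v in
  @ColoredComplex k (vert K)
    ([set q @: G | G : {set vert K} in faces K] :\ (phi @: F))
    (color (c := K)).

Definition connected_sum (k : nat) (K L : colored_complex k)
    (F : {set vert K}) (phi : vert K -> vert L) : colored_complex k :=
  identify (K := disjoint_union K L) (inl @: F)
    (fun x => match x with inl v => inr (phi v) | inr w => inr w end).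

Inductive stacked_colored (k : nat) : colored_complex k -> Prop :=
| stacked_cross : stacked_colored (cross_polytope k)
| stacked_sum (K L : colored_complex k) (F : {set vert K}) (F' : {set vert L})
    (phi : vert K -> vert L) :
    stacked_colored K -> stacked_colored L ->
    facet (faces K) F -> facet (faces L) F' -> color_bijection F F' phi ->
    stacked_colored (connected_sum F phi)
| stacked_iso (K L : colored_complex k) :
    stacked_colored K -> colored_iso K L -> stacked_colored L.

Definition stacked_cross_polytopal_sphere (k : nat) (T : finType)
    (K : {set {set T}}) : Prop :=
  exists c : T -> 'I_k, stacked_colored (ColoredComplex K c).

Inductive balanced_Walkup (d : nat) : colored_complex d -> Prop :=
| Walkup_cross : balanced_Walkup (cross_polytope d)
| Walkup_sum (K L : colored_complex d) (F : {set vert K}) (F' : {set vert L})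
    (phi : vert K -> vert L) :
    balanced_Walkup K -> balanced_Walkup L ->
    facet (faces K) F -> facet (faces L) F' -> color_bijection F F' phi ->
    balanced_Walkup (connected_sum F phi)
| Walkup_handle (K : colored_complex d) (F F' : {set vert K})
    (phi : vert K -> vert K) :
    balanced_Walkup K ->
    facet (faces K) F -> facet (faces K) F' -> [disjoint F & F'] ->
    color_bijection F F' phi ->
    (forall v w, v \in F ->
       ~ (adjacent (faces K) v w /\ adjacent (faces K) (phi v) w)) ->
    balanced_Walkup (identify F phi)
| Walkup_iso (K L : colored_complex d) :
    balanced_Walkup K -> colored_iso K L -> balanced_Walkup L.

(* Main.v *)
(** A missing face [sg] with [d] vertices is a "neck" of the complex. In the link
    of a vertex [u] of [sg] the set [sg :\ u] is a missing facet, along which a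
    stacked cross-polytopal sphere is a connected sum, so it has two sides there.
    Since [d >= 4], the boundary of [sg] is two-sided: the sides at different
    vertices of [sg] can be chosen consistently, because they agree or disagree
    globally along each edge of [sg] and every triangle of [sg] is a face.
    Cutting along [sg] and filling in two copies of it yields a complex that is
    still locally stacked, has no missing (d-2)-faces and has fewer missing
    (d-1)-faces; the original complex is recovered by a handle addition if the cut
    complex is connected, and otherwise as the connected sum of its two components.
    When there is no missing face with [d] vertices, the hypothesis on
    (d-2)-faces forces all vertex links to be cross-polytopes, hence so is the
    complex itself. *)
Require Import Defs.
From mathcomp Require Import all_boot.

Set Implicit Arguments.
Unset Strict Implicit.
Unset Printing Implicit Defensive.

(** * Stacked spheres inside a fixed vertex type *)

(** The delicate point is two-sidedness. For an edge [uu'] of [sg], the sides at [u] and those at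
    [u'] both split the link of the edge along the simplex spanned by the rest of [sg]. Each half
    stays connected when that simplex is removed, so the two labellings agree or are opposite on the
    whole link, and the edge receives a sign. A triangle of [sg] lies in a ridge [sg :\ y], hence in
    a facet with a vertex [x] off [sg]; reading the three signs at [x] shows that they cancel, so
    all sides can be oriented from one base vertex. The bound on [d] enters three times: splitting a
    vertex link needs [2 < d.-1], the link of an edge must have rank at least 2 for complements of
    facets to be connected, and a triangle needs a fourth vertex [y] of [sg]. The induction runs on
    the number of missing faces with [d] vertices. It carries [locally_stacked], which passes to the
    cut complex and to its components, while connectedness is established afresh for each piece. *)

Section Basics.
Variable T : finType.
Implicit Types (K : {set {set T}}) (F G M : {set T}) (u v w x y z : T).

Lemma in_vertices K v : (v \in vertices K) = ([set v] \in K).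
Proof. by rewrite inE. Qed.

Lemma in_link1 K u G : (G \in link K [set u]) = (u \notin G) && (u |: G \in K).
Proof. by rewrite inE disjoint_sym disjoints1 setUC. Qed.

Lemma face_vertex K F v :
  simplicial_complex K -> F \in K -> v \in F -> v \in vertices K.
Proof. by case=> _ dK FK vF; rewrite inE; apply: dK FK _; rewrite sub1set. Qed.

Lemma face_sub_vertices K F :
  simplicial_complex K -> F \in K -> F \subset vertices K.
Proof. by move=> cK FK; apply/subsetP => v; apply: face_vertex cK FK. Qed.

Lemma in_vertices_link K u x :
  (x \in vertices (link K [set u])) = (x != u) && ([set u; x] \in K).
Proof. by rewrite in_vertices in_link1 inE eq_sym. Qed.

End Basics.

Section Stacked.
Variable T : finType.
Implicit Types (K : {set {set T}}) (F G M X : {set T}) (u v w x y z : T).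

Definition antipodal X (a : T -> T) : Prop :=
  {in X, forall x, [/\ a x \in X, a x != x & a (a x) = x]}.

Definition cross_complex X (a : T -> T) : {set {set T}} :=
  [set F : {set T} | (F \subset X) && [forall x in F, a x \notin F]].

(* Colour-free, since the colouring that witnesses that a link is stacked need not
   be the restriction of the colouring of the ambient complex; the two summands
   share the vertices of the facet that is removed. *)
Inductive stacked_sphere (k : nat) : {set {set T}} -> Prop :=
| stacked_sphere_cross X a :
    antipodal X a -> #|X| = k.*2 -> stacked_sphere k (cross_complex X a)
| stacked_sphere_sum K1 K2 M :
    stacked_sphere k K1 -> stacked_sphere k K2 -> M \in K1 -> M \in K2 ->
    #|M| = k -> vertices K1 :&: vertices K2 = M ->
    stacked_sphere k ((K1 :|: K2) :\ M).

Lemma cross_complexP X a F :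
  reflect (F \subset X /\ {in F, forall x, a x \notin F})
          (F \in cross_complex X a).
Proof.
rewrite inE; apply: (iffP andP) => [[sFX /forall_inP aF]|[sFX aF]]; split=> //.
exact/forall_inP.
Qed.

Lemma cross_complex_complex X a : simplicial_complex (cross_complex X a).
Proof.
split; first by apply/cross_complexP; split=> [|x]; rewrite ?sub0set ?inE.
move=> F G /cross_complexP[sFX aF] sGF; apply/cross_complexP; split.
  exact: subset_trans sFX.
move=> x xG; apply: contra (aF x (subsetP sGF _ xG)); exact: (subsetP sGF).
Qed.

Lemma vertices_cross X a : antipodal X a -> vertices (cross_complex X a) = X.
Proof.
move=> aX; apply/setP=> x; rewrite in_vertices.
apply/cross_complexP/idP=> [[]|xX]; first by rewrite sub1set.
rewrite sub1set; split=> // y /set1P->; rewrite inE.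
by have [] := aX x xX.
Qed.

Lemma antipodal_image_disjoint X a F :
  antipodal X a -> F \in cross_complex X a ->
  [/\ F :|: a @: F \subset X, [disjoint F & a @: F] & #|F :|: a @: F| = #|F|.*2].
Proof.
move=> aX /cross_complexP[sFX aF].
have dis : [disjoint F & a @: F].
  rewrite disjoint_sym; apply/pred0P=> y /=; apply/negP=> /andP[/imsetP[x xF ->] axF].
  by have := aF x xF; rewrite axF.
split=> //.
  rewrite subUset sFX; apply/subsetP=> y /imsetP[x xF ->].
  by have [] := aX x (subsetP sFX _ xF).
rewrite cardsU (disjoint_setI0 dis) cards0 subn0.
rewrite card_in_imset ?addnn // => x y xF yF e.
have [_ _ <-] := aX x (subsetP sFX _ xF); rewrite e.
by have [_ _ ->] := aX y (subsetP sFX _ yF).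
Qed.

Lemma card_cross_face k X a F :
  antipodal X a -> #|X| = k.*2 -> F \in cross_complex X a -> #|F| <= k.
Proof.
move=> aX cX FK; have [sX _ cF] := antipodal_image_disjoint aX FK.
by have := subset_leq_card sX; rewrite cF cX leq_double.
Qed.

Lemma cross_swap X a F y :
  antipodal X a -> F \in cross_complex X a -> y \in F ->
  a y |: (F :\ y) \in cross_complex X a.
Proof.
move=> aX /cross_complexP[sFX aF] yF.
have [ayX ay aay] := aX y (subsetP sFX _ yF).
apply/cross_complexP; split.
  by rewrite subUset sub1set ayX (subset_trans _ sFX) // subsetDl.
move=> x /setU1P[->|/setD1P[nxy xF]].
  by rewrite aay !inE eqxx /= orbF eq_sym.
rewrite !inE negb_or negb_and negbK (aF _ xF) orbT andbT.
apply: contra nxy => /eqP e; have [_ _ <-] := aX x (subsetP sFX _ xF).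
by rewrite e aay.
Qed.

Lemma vertices_sum K1 K2 M :
  1 < #|M| -> vertices ((K1 :|: K2) :\ M) = vertices K1 :|: vertices K2.
Proof.
move=> cM; apply/setP=> x; rewrite !inE.
suff -> : [set x] != M by [].
by apply: contraTneq cM => <-; rewrite cards1.
Qed.

Section Rank.
Variable k : nat.
Hypothesis k_gt1 : 1 < k.

Lemma sum_complex K1 K2 M :
  simplicial_complex K1 -> simplicial_complex K2 ->
  (forall F, F \in K1 :|: K2 -> #|F| <= #|M|) -> M != set0 ->
  simplicial_complex ((K1 :|: K2) :\ M).
Proof.
move=> [K10 d1] [K20 d2] cM M0; split; first by rewrite !inE eq_sym M0 K10.
move=> F G /setD1P[nFM FK] sGF; rewrite in_setD1; apply/andP; split.
  apply: contra nFM => /eqP eGM; rewrite eGM in sGF.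
  by rewrite eq_sym eqEcard sGF cM.
by move: FK; rewrite !inE => /orP[/d1->|/d2->]; rewrite ?orbT.
Qed.

Lemma stacked_complex_card K :
  stacked_sphere k K -> simplicial_complex K /\ {in K, forall F, #|F| <= k}.
Proof.
elim=> [X a aX cX|K1 K2 M _ [c1 s1] _ [c2 s2] _ _ cM _].
  by split=> [|F]; [apply: cross_complex_complex|apply: card_cross_face].
have s12 F : F \in K1 :|: K2 -> #|F| <= k by rewrite inE => /orP[/s1|/s2].
split; last by move=> F /setD1P[_]; apply: s12.
apply: sum_complex => // [F|]; first by rewrite cM; apply: s12.
by rewrite -cards_eq0 cM -lt0n ltnW.
Qed.

Lemma stacked_complex K : stacked_sphere k K -> simplicial_complex K.
Proof. by case/stacked_complex_card. Qed.

(** Every ridge of a facet lies in a second facet. In a connected sum that second facet may be the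
    deleted [M]; the facet of the other summand across the same ridge then takes its place. *)
Lemma stacked_exchange K F y :
  stacked_sphere k K -> F \in K -> #|F| = k -> y \in F ->
  exists2 z, z \notin F & z |: (F :\ y) \in K.
Proof.
move=> sK; elim: sK F y => [X a aX cX|K1 K2 M s1 IH1 s2 IH2 M1 M2 cM V12] F y.
  move=> FK _ yF; exists (a y); last exact: cross_swap.
  by case/cross_complexP: FK => _; apply.
wlog F1 : K1 K2 s1 s2 IH1 IH2 M1 M2 V12 / F \in K1 => [wl|].
  move=> /[dup] FK /setD1P[_ /setUP[F1|F2]]; first exact: (wl K1 K2).
  move: FK; rewrite [K1 :|: K2]setUC.
  by apply: (wl K2 K1) => //; rewrite setIC.
case/setD1P=> nFM _ cF yF.
have [z nz zF] := IH1 F y F1 cF yF.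
have [e|ne] := eqVneq (z |: (F :\ y)) M; last first.
  by exists z => //; rewrite !inE ne zF.
have zM : z \in M by rewrite -e setU11.
have [w nw wM] := IH2 M z M2 cM zM.
have wF : w \notin F.
  apply: contra nw => wF; rewrite -V12 inE.
  rewrite (face_vertex (stacked_complex s1) F1) //=.
  by apply: face_vertex (stacked_complex s2) wM _; rewrite setU11.
have eF : M :\ z = F :\ y by rewrite -e setU1K // !inE (negPf nz) andbF.
exists w => //; rewrite !inE -eF wM orbT andbT.
by apply: contra nw => /eqP <-; rewrite setU11.
Qed.

Lemma stacked_pure K G :
  stacked_sphere k K -> G \in K -> exists F, [/\ F \in K, G \subset F & #|F| = k].
Proof.
move=> sK; elim: sK G => [X a aX cX|K1 K2 M s1 IH1 s2 IH2 M1 M2 cM V12] G.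
  move=> GK; have [F /maxsetP[FK maxF] sGF] := maxset_exists GK.
  exists F; split=> //; apply/eqP; rewrite eqn_leq (card_cross_face aX cX FK) /=.
  have [sX _ cF] := antipodal_image_disjoint aX FK.
  rewrite -leq_double -cX -cF; apply/subset_leq_card/subsetP=> x xX.
  have [axX nax aax] := aX x xX.
  rewrite inE; apply/orP; case: (boolP (x \in F)) => [|nxF]; [by left|right].
  case: (boolP (a x \in F)) => [axF|naxF]; first by rewrite -aax imset_f.
  have /cross_complexP[sFX aF] := FK.
  case/negP: nxF; rewrite -(maxF (x |: F)) ?setU11 ?subsetU1 //.
  apply/cross_complexP; split; first by rewrite subUset sub1set xX.
  move=> y /setU1P[->|yF]; first by rewrite !inE negb_or nax.
  rewrite !inE negb_or aF // andbT; apply: contra naxF => /eqP <-.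
  by have [_ _ ->] := aX y (subsetP sFX _ yF).
wlog G1 : K1 K2 s1 s2 IH1 IH2 M1 M2 V12 / G \in K1 => [wl|].
  move=> /[dup] GK /setD1P[_ /setUP[G1|G2]]; first exact: (wl K1 K2).
  move: GK; rewrite [K1 :|: K2]setUC.
  by apply: (wl K2 K1) => //; rewrite setIC.
case/setD1P=> nGM _; have [F [F1 sGF cF]] := IH1 G G1.
have [eFM|nFM] := eqVneq F M; last by exists F; split; rewrite // !inE nFM F1.
(* The facet found is the deleted one. As [G] misses some [y] of [M], exchanging [y] yields another
   facet of [K1] that contains [G]. *)
subst F; have /subsetPn[y yM yG] : ~~ (M \subset G).
  by apply: contra nGM => sMG; rewrite eqEsubset sGF.
have [z zM zK] := stacked_exchange s1 M1 cM yM.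
exists (z |: (M :\ y)); split.
- rewrite !inE zK andbT; apply: contra zM => /eqP <-; exact: setU11.
- by rewrite subsetU // orbC subsetD1 sGF yG.
- by rewrite cardsU1 !inE (negPf zM) andbF -cM [in RHS](cardsD1 y) yM.
Qed.

Lemma stacked_vertex_outside K F y :
  stacked_sphere k K -> F \in K -> #|F| = k -> y \in F ->
  exists2 z, z \notin F & [set y; z] \in K.
Proof.
move=> sK FK cF yF.
have [y' y'F nyy'] : exists2 y', y' \in F & y' != y.
  have /card_gt0P[y'] : 0 < #|F :\ y| by move: cF k_gt1; rewrite (cardsD1 y) yF => <-.
  by rewrite !inE => /andP[]; exists y'.
have [z zF zK] := stacked_exchange sK FK cF y'F.
exists z => //; have [_ dK] := stacked_complex sK; apply: dK zK _.
by rewrite subUset !sub1set !inE eqxx yF (eq_sym y y') nyy' orbT.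
Qed.

(** Connectedness of the complement of a facet, phrased with labellings constant along edges because
    it is applied to labellings by sides. In a cross-polytope the complement is the opposite facet.
    In a sum with [N] in [A], every vertex of [F] off [N] has a neighbour in [B] off [F], and such a
    vertex exists since [N] and [F] differ. *)
Lemma stacked_complement_connected K N (s : T -> bool) :
  stacked_sphere k K -> N \in K -> #|N| = k ->
  (forall x y, x \notin N -> y \notin N -> [set x; y] \in K -> s x = s y) ->
  {in vertices K :\: N &, forall x y, s x = s y}.
Proof.
move=> sK; elim: sK N => [X a aX cX|A B F sA IHA sB IHB FA FB cF VAB] N.
  move=> NK cN sC x y; rewrite vertices_cross // => /setDP[xX xN] /setDP[yX yN].
  apply: sC => //; have [sX _ cNa] := antipodal_image_disjoint aX NK.
  have eX : N :|: a @: N = X by apply/eqP; rewrite eqEcard sX cNa cN cX leqnn.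
  have /cross_complexP[sNX aN] := NK.
  have inN z : z \in X -> z \notin N -> a z \in N.
    rewrite -eX inE => /orP[->//|/imsetP[w wN ->] _].
    by have [_ _ ->] := aX w (subsetP sNX _ wN).
  apply/cross_complexP; split; first by rewrite subUset !sub1set xX.
  move=> z /set2P[]->; rewrite !inE; apply/norP; split.
  - by have [] := aX x xX.
  - by apply: contraNneq yN => <-; apply: inN.
  - by apply: contraNneq xN => <-; apply: inN.
  - by have [] := aX y yX.
wlog NA : A B sA sB IHA IHB FA FB VAB / N \in A => [wl|].
  move=> /[dup] NK /setD1P[_ /setUP[NA|NB]]; first exact: (wl A B).
  move: NK; rewrite [A :|: B]setUC.
  by apply: (wl B A) => //; rewrite setIC.
case/setD1P=> nNF _ cN sC.
have [cA cB] := (stacked_complex sA, stacked_complex sB).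
have outF x : x \notin F -> x \in vertices B -> x \notin N.
  move=> xF xB; apply: contra xF => xN; rewrite -VAB inE xB andbT.
  exact: face_vertex cA NA xN.
have constB : {in vertices B :\: F &, forall x y, s x = s y}.
  apply: IHB => // x y xF yF xyB; apply: sC.
  - by apply: outF => //; apply: face_vertex cB xyB _; rewrite set21.
  - by apply: outF => //; apply: face_vertex cB xyB _; rewrite set22.
  - by rewrite !inE xyB orbT andbT; apply: contraNneq xF => <-; rewrite set21.
have [z0 z0B] : exists z0, z0 \in vertices B :\: F.
  have /card_gt0P[y yF] : 0 < #|F| by rewrite cF ltnW.
  have [z zF yz] := stacked_vertex_outside sB FB cF yF.
  by exists z; rewrite inE zF (face_vertex cB yz) // set22.
have constF y : y \in F -> y \notin N -> s y = s z0.
  move=> yF yN; have [z zF yz] := stacked_vertex_outside sB FB cF yF.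
  have zB : z \in vertices B by apply: face_vertex cB yz _; rewrite set22.
  rewrite -(constB z z0) //; last by rewrite in_setD zF.
  apply: sC => //; first exact: outF.
  by rewrite !inE yz orbT andbT; apply: contraNneq zF => <-; rewrite set22.
have constA : {in vertices A :\: N &, forall x y, s x = s y}.
  apply: IHA => // x y xN yN xyA.
  (* Deleting [F] loses an edge of [A] only if [F] is that edge ([k = 2]); its ends then share their
     label through [B]. *)
  have [exyF|nxyF] := eqVneq [set x; y] F.
    by rewrite !constF // -exyF !inE eqxx ?orbT.
  by apply: sC => //; rewrite !inE nxyF xyA.
have [y yF yN] : exists2 y, y \in F & y \notin N.
  apply/subsetPn; apply: contra nNF => sFN.
  by rewrite eq_sym eqEcard sFN cF cN leqnn.
have yA : y \in vertices A :\: N by rewrite inE yN (face_vertex cA FA).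
have all0 x : x \in vertices ((A :|: B) :\ F) :\: N -> s x = s z0.
  rewrite vertices_sum ?cF // !inE -!in_vertices => /andP[xN /orP[xA|xB]].
    by rewrite -(constF y) //; apply: constA; rewrite // inE xN.
  case: (boolP (x \in F)) => [xF|xF]; first exact: constF.
  by apply: constB; rewrite // inE xF.
by move=> x y' /all0-> /all0->.
Qed.

End Rank.

(** In a cross-polytope, the link drops [u] and its antipode. In a sum, a vertex off [M] keeps its
    link from one summand, and at a vertex of [M] the two links are summed along [M :\ u]. *)
Lemma stacked_link k K u :
  0 < k -> stacked_sphere k.+1 K -> u \in vertices K ->
  stacked_sphere k (link K [set u]).
Proof.
move=> k0 sK; elim: sK u => [X a aX cX|K1 K2 M s1 IH1 s2 IH2 M1 M2 cM V12] u.
  rewrite vertices_cross // => uX; have [auX nau aau] := aX u uX.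
  have -> : link (cross_complex X a) [set u] = cross_complex (X :\ u :\ a u) a.
    apply/setP=> G; rewrite in_link1.
    apply/andP/cross_complexP=> [[uG /cross_complexP[sX aG]]|[sX aG]].
      split; last first.
        by move=> x xG; have := aG x (setU1r _ xG); rewrite !inE negb_or => /andP[].
      apply/subsetP=> x xG; rewrite !inE (subsetP sX) ?setU1r // andbT.
      have := aG u (setU11 _ _); rewrite !inE negb_or => /andP[_ auG].
      by apply/andP; split; [apply: contraNneq auG => <-|apply: contraNneq uG => <-].
    have uG : u \notin G by apply/negP=> /(subsetP sX); rewrite !inE eqxx andbF.
    split=> //; apply/cross_complexP; split.
      rewrite subUset sub1set uX; apply: subset_trans sX _.
      by rewrite (subset_trans (subsetDl _ _)) // subsetDl.
    move=> x /setU1P[->|xG].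
      rewrite !inE negb_or nau /=; apply/negP=> /(subsetP sX).
      by rewrite !inE eqxx.
    rewrite !inE negb_or aG // andbT; apply: contraTneq xG => axu.
    apply/negP=> /(subsetP sX); rewrite !inE => /and3P[nx _ xX].
    by have [_ _ e] := aX x xX; rewrite -e axu eqxx in nx.
  apply: stacked_sphere_cross.
    move=> x; rewrite !inE => /and3P[xau xu xX]; have [axX nax aax] := aX x xX.
    split=> //; rewrite axX andbT; apply/andP; split.
      by apply: contra_neq xu => e; rewrite -aax e.
    by apply: contra_neq xau => e; rewrite -aax e.
  by move: cX; rewrite (cardsD1 u) uX (cardsD1 (a u)) !inE nau auX doubleS => -[].
have k1 : 1 < k.+1 by [].
have [c1 c2] := (stacked_complex k1 s1, stacked_complex k1 s2).
rewrite vertices_sum ?cM // => uV.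
have [uM|uM] := boolP (u \in M); last first.
  wlog u1 : K1 K2 s1 s2 IH1 IH2 M1 M2 V12 c1 c2 uV / u \in vertices K1 => [wl|].
    have /setUP[u1|u2] := uV; first exact: (wl K1 K2).
    by rewrite [K1 :|: K2]setUC; apply: (wl K2 K1) => //;
      rewrite ?[vertices K2 :&: _]setIC // setUC.
  rewrite (_ : link _ _ = link K1 [set u]); first exact: IH1.
  apply/setP=> G; rewrite !in_link1; case: (u \notin G) => //=.
  rewrite !inE; have -> : u |: G != M by apply: contraNneq uM => <-; rewrite setU11.
  rewrite orb_idr // => G2; case/negP: uM; rewrite -V12 inE u1.
  by apply: face_vertex c2 G2 _; rewrite setU11.
have Mvert L : simplicial_complex L -> M \in L -> u \in vertices L.
  by move=> cL ML; apply: face_vertex cL ML uM.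
have Mu (L : {set {set T}}) : M \in L -> M :\ u \in link L [set u].
  by move=> ML; rewrite in_link1 setD1K // ML !inE eqxx.
rewrite (_ : link _ _ = (link K1 [set u] :|: link K2 [set u]) :\ (M :\ u)).
  apply: stacked_sphere_sum; rewrite ?Mu //.
  - by apply: IH1; apply: Mvert.
  - by apply: IH2; apply: Mvert.
  - by move: cM; rewrite (cardsD1 u) uM => -[].
  apply/setP=> x; rewrite in_setI !in_vertices_link -V12 in_setD1 in_setI.
  case: (eqVneq x u) => //= nxu; apply/andP/andP=> [[x1 x2]|[x1 x2]].
    by rewrite (face_vertex c1 x1) ?(face_vertex c2 x2) ?set22.
  have xM : x \in M by rewrite -V12 inE x1.
  have sM : [set u; x] \subset M by rewrite subUset !sub1set uM.
  by case: c1 => _ d1; case: c2 => _ d2; split; [apply: d1 M1 sM|apply: d2 M2 sM].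
apply/setP=> G; rewrite in_setD1 in_setU !in_link1 in_setD1 in_setU.
case: (boolP (u \in G)) => uG /=; first by rewrite andbF.
by congr (~~ _ && _); apply/eqP/eqP => [<-|->]; rewrite ?setU1K ?setD1K.
Qed.

(** Agrees with [missing_face] on sets with at least two elements, whose singletons are then
    faces. *)
Definition hollow K M : Prop := M \notin K /\ (forall G, G \proper M -> G \in K).

(** Since [2 < k], all pairs in [M] are edges, so a cross-polytope has no such [M]: without
    antipodal pairs it would be a face. In a sum along [F] different from [M], the set [M] is
    already a missing facet of one summand, which splits by induction; the other summand is then
    reattached. *)
Lemma stacked_hollow_split k K M :
  2 < k -> stacked_sphere k K -> #|M| = k -> hollow K M ->
  exists K1 K2, [/\ stacked_sphere k K1, stacked_sphere k K2,
    M \in K1 /\ M \in K2, vertices K1 :&: vertices K2 = M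
    & K = (K1 :|: K2) :\ M].
Proof.
move=> k2 sK cM; have k1 : 1 < k by apply: ltnW.
have pairM x y : x \in M -> y \in M -> [set x; y] \proper M.
  move=> xM yM; rewrite properEcard subUset !sub1set xM yM cM /=.
  by apply: leq_ltn_trans k2; rewrite cards2; case: (x != y).
elim: sK => [X a aX cX [nMK hM]|A B F sA IHA sB IHB FA FB cF VAB].
  case/negP: nMK; apply/cross_complexP; split.
    apply/subsetP=> x xM; have /hM/cross_complexP[+ _] := pairM x x xM xM.
    by rewrite subUset sub1set => /andP[].
  move=> x xM; apply/negP=> axM.
  have /hM/cross_complexP[_ /(_ x)] := pairM x (a x) xM axM.
  by rewrite set21 set22 => /(_ isT).
case=> nMK hM; have [eMF|nMF] := eqVneq M F.
  by exists A, B; rewrite eMF; split.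
have [cA cB] := (stacked_complex k1 sA, stacked_complex k1 sB).
(* If some [x] of [M] is not a vertex of [A], all edges from [x] inside [M] lie in [B], so [M]
   consists of vertices of [B]. *)
wlog sMA : A B sA sB IHA IHB FA FB VAB nMK hM cA cB / M \subset vertices A => [wl|].
  case: (boolP (M \subset vertices A)) => [sMA|/subsetPn[x xM xA]].
    exact: (wl A B).
  rewrite [A :|: B]setUC; apply: (wl B A) => //; rewrite 1?setIC //.
    by rewrite setUC.
    by rewrite setUC.
  apply/subsetP=> y yM; have := hM _ (pairM x y xM yM);
    rewrite !inE => /andP[_ /orP[]] xyK.
    by case/negP: xA; apply: face_vertex cA xyK _; rewrite set21.
  by rewrite -in_vertices; apply: face_vertex cB xyK _; rewrite set22.
have hMA : hollow A M.
  split; first by apply: contra nMK; rewrite !inE nMF => ->.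
  move=> G pGM; have := hM _ pGM; rewrite !inE => /andP[_ /orP[//|GB]].
  case: cA => _ dA; apply: dA FA _; rewrite -VAB subsetI (face_sub_vertices cB) //.
  by rewrite (subset_trans (proper_sub pGM)).
have [A1 [A2 [s1 s2 [M1 M2] V12 eA]]] := IHA hMA.
(* [B] goes to the half of [A] that contains [F]. *)
wlog F1 : A1 A2 s1 s2 M1 M2 V12 eA / F \in A1 => [wl|].
  have : F \in (A1 :|: A2) :\ M by rewrite -eA.
  case/setD1P=> _ /setUP[F1|F2]; first exact: (wl A1 A2).
  by apply: (wl A2 A1) => //; rewrite 1?setIC // setUC.
have [c1 c2] := (stacked_complex k1 s1, stacked_complex k1 s2).
have VA : vertices A = vertices A1 :|: vertices A2 by rewrite eA vertices_sum ?cM.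
have eqF : F \subset M -> False.
  by move=> sFM; case/eqP: nMF; apply/esym/eqP; rewrite eqEcard sFM cF cM leqnn.
have eqM : M \subset F -> False.
  by move=> sMF; case/eqP: nMF; apply/eqP; rewrite eqEcard sMF cF cM leqnn.
have V1B : vertices A1 :&: vertices B = F.
  apply/eqP; rewrite eqEsubset; apply/andP; split.
    by rewrite -VAB VA setSI // subsetUl.
  by rewrite subsetI (face_sub_vertices c1) // (face_sub_vertices cB).
exists ((A1 :|: B) :\ F), A2; split=> //.
- exact: stacked_sphere_sum.
- by split=> //; rewrite !inE nMF M1.
- rewrite vertices_sum ?cF //; apply/eqP; rewrite eqEsubset; apply/andP; split.
    rewrite setIUl subUset V12 subxx /=; apply/subsetP=> x /setIP[xB x2].
    rewrite -V12 inE x2 andbT; apply: face_vertex c1 F1 _.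
    by rewrite -VAB VA !inE -!in_vertices x2 xB orbT.
  by rewrite subsetI (face_sub_vertices c2) // subsetU // (face_sub_vertices c1).
apply/setP=> G; rewrite eA !inE.
case: (eqVneq G M) => [->|nGM] /=.
  rewrite nMF /=; apply/negP=> MB; apply: eqM; rewrite -VAB subsetI sMA.
  exact: face_sub_vertices.
case: (eqVneq G F) => [->|nGF] /=; last by rewrite orbAC.
apply/esym/negP=> F2; apply: eqF; rewrite -V12 subsetI !face_sub_vertices //.
Qed.

Lemma stacked_flag_cross k K :
  1 < k -> stacked_sphere k K -> (forall M, #|M| = k -> ~ hollow K M) ->
  exists X a, [/\ antipodal X a, #|X| = k.*2 & K = cross_complex X a].
Proof.
move=> k1; case=> [X a aX cX _|K1 K2 M s1 s2 M1 M2 cM V12 /(_ M cM) []].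
  by exists X, a.
split; first by rewrite !inE eqxx.
move=> G; rewrite properEneq => /andP[nGM sGM]; rewrite !inE nGM.
by have [_ d1] := stacked_complex k1 s1; rewrite (d1 _ _ M1).
Qed.

End Stacked.

(** * Relabelling vertices, and from coloured to colour-free stacked spheres *)

Lemma map_vertices (T T' : finType) (f : T -> T') (K : {set {set T}}) :
  simplicial_complex K ->
  vertices [set f @: F | F : {set T} in K] = f @: vertices K.
Proof.
move=> cK; apply/setP=> y; rewrite in_vertices; apply/imsetP/imsetP=> -[].
  move=> F FK e; have : y \in f @: F by rewrite -e set11.
  by case/imsetP=> x xF ->; exists x => //; apply: face_vertex cK FK xF.
by move=> x; rewrite in_vertices => xK ->; exists [set x]; rewrite ?imset_set1.
Qed.

Lemma imset_inj_sub (T T' : finType) (f : T -> T') (V F G : {set T}) :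
  {in V &, injective f} -> F \subset V -> G \subset V -> f @: F = f @: G -> F = G.
Proof.
move=> fI; wlog suff : F G / F \subset V -> G \subset V -> f @: F = f @: G ->
  F \subset G.
  move=> h sF sG e; apply/eqP; rewrite eqEsubset; apply/andP; split; exact: h.
move=> sF sG e; apply/subsetP=> x xF.
have : f x \in f @: G by rewrite -e imset_f.
by case/imsetP=> y yG /fI-> //; [apply: (subsetP sF)|apply: (subsetP sG)].
Qed.

Lemma stacked_map (T T' : finType) (f : T -> T') k (K : {set {set T}}) :
  1 < k -> stacked_sphere k K -> {in vertices K &, injective f} ->
  stacked_sphere k [set f @: F | F : {set T} in K].
Proof.
move=> k1; elim=> [X a aX cX|K1 K2 M s1 IH1 s2 IH2 M1 M2 cM V12].
  rewrite vertices_cross // => fI.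
  (* [g] inverts [f] on [X], so [a'] is the antipodal map carried over to [f @: X], extended by the
     identity. *)
  pose g y := [pick x in X | f x == y].
  have gK x : x \in X -> g (f x) = Some x.
    move=> xX; rewrite /g; case: pickP => [x' /andP[x'X /eqP e]|/(_ x)].
      by rewrite (fI x' x).
    by rewrite xX eqxx.
  pose a' y := if g y is Some x then f (a x) else y.
  have aE x : x \in X -> a' (f x) = f (a x) by move=> xX; rewrite /a' gK.
  have -> : [set f @: F | F : {set T} in cross_complex X a] = cross_complex (f @: X) a'.
    apply/setP=> G;
      apply/imsetP/cross_complexP=> [[F /cross_complexP[sFX aF] ->]|[sG aG]].
      split; first exact: imsetS.
      move=> _ /imsetP[x xF ->]; have xX := subsetP sFX _ xF; rewrite aE //.
      have [axX _ _] := aX x xX; apply: contra (aF x xF) => /imsetP[z zF e].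
      by rewrite (fI _ _ axX (subsetP sFX _ zF) e).
    exists [set x in X | f x \in G].
      apply/cross_complexP; split; first by apply/subsetP=> x; rewrite inE => /andP[].
      move=> x; rewrite inE => /andP[xX fxG]; rewrite inE -aE // (negPf (aG _ fxG)).
      by rewrite andbF.
    apply/setP=> y; apply/idP/imsetP=> [yG|[x]]; last by rewrite inE => /andP[_ fG] ->.
    have /imsetP[x xX e] := subsetP sG _ yG.
    by exists x => //; rewrite inE xX -e.
  apply: stacked_sphere_cross; last by rewrite card_in_imset.
  move=> _ /imsetP[x xX ->]; have [axX nax aax] := aX x xX.
  rewrite !aE // aax; split=> //; first exact: imset_f.
  by apply: contra_neq nax; apply: fI.
have [c1 c2] := (stacked_complex k1 s1, stacked_complex k1 s2).
rewrite vertices_sum ?cM // => fI.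
have fI1 : {in vertices K1 &, injective f}.
  by move=> x y x1 y1; apply: fI; rewrite in_setU ?x1 ?y1.
have fI2 : {in vertices K2 &, injective f}.
  by move=> x y x1 y1; apply: fI; rewrite in_setU ?x1 ?y1 orbT.
have sub (F : {set T}) : F \in K1 :|: K2 -> F \subset vertices K1 :|: vertices K2.
  rewrite inE => /orP[/(face_sub_vertices c1)|/(face_sub_vertices c2)] sF.
    by rewrite subsetU // sF.
  by rewrite subsetU // sF orbT.
have MK : M \in K1 :|: K2 by rewrite inE M1.
rewrite (_ : [set _ | _ in _] =
  ([set f @: F | F : {set T} in K1] :|: [set f @: F | F : {set T} in K2]) :\ (f @: M)).
  apply: stacked_sphere_sum; rewrite ?imset_f //; try by [apply: IH1|apply: IH2].
    rewrite card_in_imset // => x y xM yM.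
    by apply: fI1; [apply: face_vertex c1 M1 xM|apply: face_vertex c1 M1 yM].
  rewrite !map_vertices // -V12; apply/setP=> y; apply/setIP/imsetP.
    case=> /imsetP[x1 xV1 e1] /imsetP[x2 xV2 e2]; exists x1 => //.
    rewrite inE xV1 (fI x1 x2) ?inE -?in_vertices ?xV1 ?xV2 ?orbT //.
    by rewrite -e1.
  by case=> x /setIP[xV1 xV2] ->; rewrite !imset_f.
rewrite -imsetU; apply/setP=> G; rewrite in_setD1.
apply/imsetP/andP=> [[F /setD1P[nFM FK] ->]|[nGM /imsetP[F FK e]]].
  split; last exact: imset_f.
  by apply: contra nFM => /eqP/(imset_inj_sub fI)->; rewrite ?sub.
exists F => //; rewrite in_setD1 FK andbT; apply: contra nGM => /eqP <-.
by rewrite e.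
Qed.

Lemma stacked_facet (T : finType) k (K : {set {set T}}) F :
  1 < k -> stacked_sphere k K -> facet K F -> F \in K /\ #|F| = k.
Proof.
move=> k1 sK /maxsetP[FK maxF]; split=> //.
have [G [GK sFG <-]] := stacked_pure k1 sK FK.
by rewrite -(maxF G).
Qed.

(** The left inclusion followed by the quotient map. It is injective when [phi] is injective on [F],
    which turns the quotient in [connected_sum] into a union of two relabelled complexes that share
    a facet. *)
Definition glue_inl k (K L : colored_complex k) (F : {set vert K})
    (phi : vert K -> vert L) (v : vert K) : vert K + vert L :=
  if v \in F then inr (phi v) else inl v.

Lemma connected_sum_faces k (K L : colored_complex k) (F : {set vert K})
    (phi : vert K -> vert L) :
  faces (connected_sum F phi) =
  ([set glue_inl F phi @: G | G : {set vert K} in faces K] :|: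
   [set inr @: G | G : {set vert L} in faces L]) :\ (inr @: (phi @: F)).
Proof.
rewrite /connected_sum /identify /= imsetU -!imset_comp.
congr ((_ :|: _) :\ _); apply: eq_imset => G /=; rewrite -imset_comp.
  by apply: eq_imset => v /=; rewrite mem_imset //; apply: inl_inj.
apply: eq_imset => v /=; case: ifP => // /imsetP[] //.
Qed.

Lemma glue_inl_inj k (K L : colored_complex k) (F : {set vert K})
    (phi : vert K -> vert L) :
  {in F &, injective phi} -> injective (glue_inl F phi).
Proof.
move=> phiI x y; rewrite /glue_inl.
by case: ifP => xF; case: ifP => yF // -[] //; apply: phiI.
Qed.

Lemma stacked_colored_sphere k (K : colored_complex k) :
  1 < k -> stacked_colored K -> stacked_sphere k (faces K).
Proof.
move=> k1; elim=> {K} [|K L F F' phi _ sK _ sL fF fF' [phiI eF' _]|K L _ sK [f [fI -> _]]].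
- pose a (p : 'I_k * bool) := (p.1, ~~ p.2).
  rewrite /= (_ : finset _ = cross_complex setT a).
    apply: stacked_sphere_cross;
      last by rewrite cardsT card_prod card_ord card_bool muln2.
    by move=> [i b] _; rewrite !inE /a /= negbK; split=> //;
      rewrite xpair_eqE eqxx; case: b.
  apply/setP=> F; rewrite inE; apply/forallP/cross_complexP => [h|[_ h] i].
    split; first exact: subsetT.
    by move=> [i []] pF; have := h i; rewrite pF //= ?andbT.
  by apply/negP=> /andP[tF fF]; have := h _ tF; rewrite /a /= fF.
- rewrite -eF' in fF'; have [FK cF] := stacked_facet k1 sK fF;
  have [] := stacked_facet k1 sL fF'.
  move=> F'L cF'; rewrite connected_sum_faces.
  have gI := glue_inl_inj phiI.
  have cK := stacked_complex k1 sK; have cL := stacked_complex k1 sL.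
  have eF : glue_inl F phi @: F = inr @: (phi @: F).
    by rewrite -imset_comp; apply: eq_in_imset => v vF; rewrite /glue_inl vF.
  apply: stacked_sphere_sum.
  + by apply: stacked_map => // x y _ _; apply: gI.
  + by apply: stacked_map => // x y _ _; apply: inr_inj.
  + by rewrite -eF imset_f.
  + by rewrite imset_f.
  + by rewrite card_imset //; apply: inr_inj.
  rewrite !map_vertices //; apply/eqP; rewrite eqEsubset; apply/andP; split.
    apply/subsetP=> _ /setIP[/imsetP[v vK ->] /imsetP[w wL]].
    by rewrite /glue_inl; case: ifP => // vF _; rewrite !imset_f.
  rewrite subsetI -{1}eF imsetS ?face_sub_vertices // imsetS //.
  exact: face_sub_vertices.
- exact: stacked_map.
Qed.

(** * The two sides of a missing face *)

Section Sides.
Variables (T : finType) (d : nat) (K : {set {set T}}) (sg : {set T}).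
Hypotheses (d_ge4 : 4 <= d) (cK : simplicial_complex K)
  (linkK : {in vertices K, forall v, stacked_sphere d.-1 (link K [set v])})
  (card_sg : #|sg| = d) (hollow_sg : hollow K sg).
Implicit Types (S : bool -> {set {set T}}) (F G : {set T}) (u v x y z : T) (b : bool).

(** Each side contains the simplex [sg :\ u], so it is a complete sphere. Indexing by [bool] makes a
    change of orientation an exclusive or. *)
Definition sides_at S u : Prop :=
  [/\ forall b, stacked_sphere d.-1 (S b), forall b, sg :\ u \in S b,
      vertices (S true) :&: vertices (S false) = sg :\ u
    & link K [set u] = (S true :|: S false) :\ (sg :\ u)].

Let d1 : 1 < d.-1. Proof. by case: d d_ge4 => [|[|[|[|]]]]. Qed.

Lemma proper_sg_face G : G \proper sg -> G \in K.
Proof. by case: hollow_sg => _; apply. Qed.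

Lemma sg_vertex u : u \in sg -> u \in vertices K.
Proof.
move=> usg; rewrite in_vertices; apply: proper_sg_face.
by rewrite properEcard sub1set usg cards1 card_sg (leq_trans _ d_ge4).
Qed.

Lemma card_sgD1 u : u \in sg -> #|sg :\ u| = d.-1.
Proof. by move=> usg; move: card_sg; rewrite (cardsD1 u) usg => <-. Qed.

Lemma sides_exist u : u \in sg -> exists S, sides_at S u.
Proof.
move=> usg; have sL := linkK (sg_vertex usg).
have hM : hollow (link K [set u]) (sg :\ u).
  split; first by rewrite in_link1 setD1K // (negPf hollow_sg.1) andbF.
  move=> G pG; have uG : u \notin G.
    by apply/negP=> /(subsetP (proper_sub pG)); rewrite !inE eqxx.
  rewrite in_link1 uG; apply: proper_sg_face.
  rewrite properEcard subUset sub1set usg (subset_trans (proper_sub pG)) ?subsetDl //=.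
  rewrite cardsU1 uG add1n card_sg.
  by have := proper_card pG; rewrite card_sgD1 //; case: d d_ge4.
(* The rank bound of [stacked_hollow_split], here exactly [4 <= d]. *)
have d2 : 2 < d.-1 by case: d d_ge4 => [|[|[|[|]]]].
have [K1 [K2 [s1 s2 [M1 M2] V12 e]]] := stacked_hollow_split d2 sL (card_sgD1 usg) hM.
by exists (fun b => if b then K1 else K2); split=> // -[].
Qed.

Section OneVertex.
Variables (S : bool -> {set {set T}}) (u : T).
Hypotheses (usg : u \in sg) (sidesS : sides_at S u).

Lemma side_face b G : G \in S b -> ~~ (G \subset sg) -> G \in link K [set u].
Proof.
case: sidesS => _ _ _ -> GS nG; rewrite in_setD1; apply/andP; split.
  by apply: contra nG => /eqP->; apply: subsetDl.
by rewrite in_setU; case: b GS => ->; rewrite ?orbT.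
Qed.

Lemma link_side G : G \in link K [set u] -> exists b, G \in S b.
Proof.
by case: sidesS => _ _ _ -> /setD1P[_ /setUP[]]; [exists true|exists false].
Qed.

Lemma side_complex b : simplicial_complex (S b).
Proof. by case: sidesS => sS _ _ _; apply: stacked_complex (sS b). Qed.

Lemma side_vertexE b x : x \in vertices (S b) -> x \notin sg ->
  (x \in vertices (S true)) = b.
Proof.
case: sidesS => _ _ e _; case: b => // xf xsg; apply/negP=> xt.
have : x \in sg :\ u by rewrite -e inE xt.
by rewrite !inE (negPf xsg) andbF.
Qed.

Lemma center_notin_side b : u \notin vertices (S b).
Proof.
rewrite in_vertices; apply/negP=> uS.
have : [set u] \in (S true :|: S false) :\ (sg :\ u).
  rewrite in_setD1 in_setU; apply/andP; split.
    by apply/eqP=> /setP/(_ u); rewrite !inE eqxx.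
  by case: b uS => ->; rewrite ?orbT.
by case: sidesS => _ _ _ <-; rewrite in_link1 !inE eqxx.
Qed.

(** The edge [xy] of the link of [u] lies in one of the two sides, and off [sg] the sides have no
    common vertex. *)
Lemma side_vertex_link x y : x \notin sg -> y \notin sg -> [set u; x; y] \in K ->
  (x \in vertices (S true)) = (y \in vertices (S true)).
Proof.
move=> xsg ysg uxy; have [|b xyS] := @link_side [set x; y].
  rewrite in_link1 setUA uxy andbT !inE negb_or.
  by apply/andP; split; [apply: contraNneq xsg => <-|apply: contraNneq ysg => <-].
have cS := side_complex b.
by rewrite !(@side_vertexE b) //; apply: face_vertex cS xyS _; rewrite !inE eqxx ?orbT.
Qed.

Lemma side_outside v b : v \in sg -> v != u ->
  exists2 z, z \notin sg & [set v; z] \in S b.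
Proof.
move=> vsg nvu; case: (sidesS) => sS MS _ _.
have [||z zsg vz] := stacked_vertex_outside d1 (sS b) (MS b) (y := v).
- exact: card_sgD1.
- by rewrite in_setD1 nvu.
exists z => //; apply: contra zsg => zsg; rewrite in_setD1 zsg andbT.
apply: contraNneq (center_notin_side b) => <-.
by apply: face_vertex (side_complex b) vz _; rewrite set22.
Qed.

End OneVertex.

(* The two sides at u and at u' cut the link of the edge uu' along the same
   boundary of a simplex, whose complement has only two components. *)
Lemma sides_agree S S' u u' : u \in sg -> u' \in sg -> u' != u ->
  sides_at S u -> sides_at S' u' ->
  exists e, forall x, x \notin sg -> [set u; u'; x] \in K ->
    (x \in vertices (S' true)) = (x \in vertices (S true)) (+) e.
Proof.
move=> usg u'sg nu hS hS'.
have cS b : simplicial_complex (S b) by apply: side_complex hS _.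
have cS' b : simplicial_complex (S' b) by apply: side_complex hS' _.
case: (hS) => sS MS _ _.
pose s x := x \in vertices (S' true).
(* Side [b] of the link of the edge [uu'], as seen from [u], has rank [d - 2 >= 2]. The complement
   of its facet [sg :\ u :\ u'] is connected, so the label seen from [u'] is constant there. *)
have const b : {in vertices (link (S b) [set u']) :\: (sg :\ u :\ u') &,
    forall x y, s x = s y}.
  have MSb := MS b; have d11 : d.-2.+1 = d.-1 by case: d d_ge4 => [|[]].
  have u'V : u' \in vertices (S b).
    by apply: face_vertex (cS b) MSb _; rewrite in_setD1 nu.
  have sLb : stacked_sphere d.-2 (link (S b) [set u']).
    by apply: stacked_link; rewrite ?d11 //; case: d d_ge4 => [|[|[|]]].
  apply: (stacked_complement_connected _ sLb).
  - by case: d d_ge4 => [|[|[|[|]]]].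
  - by rewrite in_link1 in_setD1 eqxx /= setD1K // in_setD1 nu.
  - by have := card_sgD1 usg; rewrite (cardsD1 u') in_setD1 nu u'sg => <-.
  move=> x y xN yN; rewrite in_link1 => /andP[u'xy xyS].
  have out z : z \notin sg :\ u :\ u' -> z \in [set x; y] -> z \notin sg.
    rewrite !in_setD1 => zN zxy; apply: contra zN => ->; rewrite andbT.
    apply/andP; split; first by apply: contraNneq u'xy => <-.
    apply: contraNneq (center_notin_side hS b) => <-.
    by apply: face_vertex (cS b) xyS _; rewrite setU1r.
  have xsg := out x xN (set21 _ _); have ysg := out y yN (set22 _ _).
  apply: (side_vertex_link u'sg hS') => //.
  have /(side_face hS xyS) : ~~ (u' |: [set x; y] \subset sg).
    by apply: contra xsg => /subsetP; apply; rewrite !inE eqxx orbT.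
  rewrite in_link1 => /andP[_ xyK]; case: cK => _ dK; apply: dK xyK _.
  by rewrite -setUA subsetUr.
have memL x b : x \notin sg -> [set u'; x] \in S b ->
    x \in vertices (link (S b) [set u']) :\: (sg :\ u :\ u').
  move=> xsg xS; rewrite inE !in_setD1 (negPf xsg) !andbF in_vertices_link xS andbT.
  by apply: contraNneq xsg => ->.
have [z0 z0sg z0S] := side_outside usg hS false u'sg nu.
have [z1 z1sg z1S] := side_outside usg hS true u'sg nu.
pose t b := if b then s z1 else s z0.
have tE x : x \notin sg -> [set u; u'; x] \in K -> s x = t (x \in vertices (S true)).
  move=> xsg xK; have [|b xS] := link_side hS (G := [set u'; x]).
    rewrite in_link1 setUA xK andbT !inE negb_or eq_sym nu.
    by apply: contraNneq xsg => <-.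
  rewrite (side_vertexE hS (b := b)) //; last first.
    by apply: face_vertex (cS b) xS _; rewrite set22.
  by case: b xS => xS; [apply: (const true)|apply: (const false)]; rewrite ?memL.
have [et|nt] := eqVneq (t true) (t false); last first.
  exists (t false) => x xsg xK; rewrite -/(s x) tE //.
  by case: (x \in vertices (S true)); move: nt; case: (t true); case: (t false).
(* If both halves had the same label, all vertices of the link of [uu'] off [sg] would lie on one
   side at [u']; but [side_outside] gives a vertex on the opposite side. *)
have nu' : u != u' by rewrite eq_sym.
have [z zsg zS] := side_outside u'sg hS' (~~ t true) usg nu'.
have sz : s z = ~~ t true.
  by apply: (side_vertexE hS') => //; apply: face_vertex (cS' _) zS _; rewrite set22.
have zK : [set u; u'; z] \in K.
  have /(side_face hS' zS) : ~~ ([set u; z] \subset sg).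
    by apply: contra zsg => /subsetP; apply; rewrite set22.
  by rewrite in_link1 => /andP[_]; rewrite setUA [[set u'] :|: _]setUC.
by move: sz; rewrite tE //; case: (_ \in _); rewrite ?et; case: (t false).
Qed.

Lemma sides_flip S u e : sides_at S u -> sides_at (fun b => S (b (+) e)) u.
Proof. by case: e => -[sS MS V e]; split=> //=; rewrite 1?setIC // setUC. Qed.

(** As [4 <= d], some ridge [sg :\ y] contains all three vertices. A facet through it has one more
    vertex, which cannot be [y] because [sg] is not a face. *)
Lemma triangle_outside u v w : u \in sg -> v \in sg -> w \in sg ->
  exists2 x, x \notin sg & [/\ [set u; v; x] \in K, [set u; w; x] \in K & [set v;
    w; x] \in K].
Proof.
move=> usg vsg wsg; have [y ysg nyuvw] : exists2 y, y \in sg & y \notin [set u; v; w].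
  apply/subsetPn; apply/negP=> /subset_leq_card; rewrite card_sg leqNgt.
  by rewrite (leq_trans _ d_ge4) // ltnS -setUA cardsU1 cards2;
    case: (_ \notin _); case: (_ != _).
have MK : sg :\ y \in K by apply: proper_sg_face; apply: properD1.
have uM : u \in sg :\ y by rewrite in_setD1 usg andbT;
  apply: contraNneq nyuvw => <-; rewrite !inE eqxx.
have vM : v \in sg :\ y by rewrite in_setD1 vsg andbT;
  apply: contraNneq nyuvw => <-; rewrite !inE eqxx orbT.
have wM : w \in sg :\ y by rewrite in_setD1 wsg andbT;
  apply: contraNneq nyuvw => <-; rewrite !inE eqxx orbT.
have MuL : sg :\ y :\ u \in link K [set u] by rewrite in_link1 setD1K // MK !inE eqxx.
have [F [FL sMF cF]] := stacked_pure d1 (linkK (sg_vertex usg)) MuL.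
move: FL; rewrite in_link1 => /andP[uF FK].
have /subsetPn[x xF xM] : ~~ (F \subset sg :\ y :\ u).
  apply/negP=> /subset_leq_card; rewrite cF.
  have := card_sgD1 ysg; rewrite (cardsD1 u) uM => <-; by rewrite ltnn.
have sM : sg :\ y \subset u |: F by rewrite -(setD1K uM) setUS.
have [_ dK] := cK.
exists x.
  apply/negP=> xsg; have exy : x = y.
    apply/eqP; apply: contraNT xM => nxy; rewrite !in_setD1 nxy xsg andbT.
    by rewrite andbT; apply: contraNneq uF => <-.
  case/negP: hollow_sg.1; apply: dK FK _; rewrite -(setD1K ysg) subUset sM sub1set.
  by rewrite -exy setU1r.
have xuF : x \in u |: F by rewrite setU1r.
have tri a (b : T) : a \in sg :\ y -> b \in sg :\ y -> [set a; b; x] \in K.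
  move=> aM bM; apply: dK FK _.
  by rewrite !subUset !sub1set xuF !(subsetP sM).
by split; apply: tri.
Qed.

(** The sides at each [u] are flipped, if necessary, to agree with those at a base vertex [u0].
    Agreement between two other vertices is then forced by the triangle that they form with [u0]. *)
Lemma consistent_sides : exists S : T -> bool -> {set {set T}},
  {in sg, forall u, sides_at (S u) u} /\
  {in sg &, forall u u' x, x \notin sg -> [set u; u'; x] \in K ->
     (x \in vertices (S u true)) = (x \in vertices (S u' true))}.
Proof.
have [S0 hS0] : exists S0 : T -> bool -> {set {set T}},
    forall u, u \in sg -> sides_at (S0 u) u.
  apply: fin_all_exists (fun u S => u \in sg -> sides_at S u) _ => u.
  case: (boolP (u \in sg)) => [/sides_exist[S hS]|_]; first by exists S.
  by exists (fun _ => set0).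
have /card_gt0P[u0 u0sg] : 0 < #|sg| by rewrite card_sg (leq_trans _ d_ge4).
have [e he] : exists e : T -> bool, forall u, u \in sg -> forall x, x \notin sg ->
    [set u0; u; x] \in K ->
    (x \in vertices (S0 u true)) = (x \in vertices (S0 u0 true)) (+) e u.
  apply: fin_all_exists (fun u e => u \in sg -> forall x, x \notin sg ->
    [set u0; u; x] \in K ->
    (x \in vertices (S0 u true)) = (x \in vertices (S0 u0 true)) (+) e) _ => u.
  case: (boolP (u \in sg)) => [usg|_]; last by exists false.
  have [->|nu] := eqVneq u u0; first by exists false => *; rewrite addbF.
  have [e he] := sides_agree u0sg usg nu (hS0 _ u0sg) (hS0 _ usg).
  by exists e => _.
pose S u b := S0 u (b (+) e u).
have hS u : u \in sg -> sides_at (S u) u by move=> usg; apply: sides_flip (hS0 u usg).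
exists S; split=> // u u' usg u'sg x xsg xK.
have [->//|nu] := eqVneq u' u.
have [e' he'] := sides_agree usg u'sg nu (hS _ usg) (hS _ u'sg).
suff e'0 : e' = false by rewrite (he' x) // e'0 addbF.
(* The sign [e'] is the same for all [x], so it suffices to evaluate it at one vertex [y] adjacent
   to all three. *)
have [y ysg [y1 y2 y3]] := triangle_outside u0sg usg u'sg.
have flip v : v \in sg -> [set u0; v; y] \in K ->
    (y \in vertices (S v true)) = (y \in vertices (S0 u0 true)).
  move=> vsg yK; rewrite /S; have := he v vsg y ysg yK.
  case: (e v) => /=; last by rewrite addbF.
  have [b yS] : exists b, y \in vertices (S0 v b).
    have /(link_side (hS0 v vsg))[b yS] : [set y] \in link K [set v].
      rewrite in_link1 in_set1; apply/andP; split.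
        by apply: contraNneq ysg => <-.
      by case: cK => _ dK; apply: dK yK _; rewrite -setUA subsetUr.
    by exists b; rewrite in_vertices.
  have := side_vertexE (hS0 v vsg) yS ysg.
  case: b yS => yS yE; rewrite yE addbT => /esym/(canRL negbK) ->; last by rewrite yS.
  apply/negP=> yf; case: (hS0 v vsg) => _ _ eV _.
  have : y \in sg :\ v by rewrite -eV inE yE.
  by rewrite in_setD1 (negPf ysg) andbF.
have := he' y ysg y3; rewrite !flip //.
by case: (_ \in _); case: (e').
Qed.

End Sides.

(** * Cutting along a missing face *)

Section Cut.
Variables (T : finType) (d : nat) (K : {set {set T}}) (sg : {set T}).
Variable (s : T -> T -> bool).
Implicit Types (F G : {set T}) (H M : {set T * bool}) (p q : T * bool).

(* The copies of u in sg are (u, true) and (u, false); any other vertex x is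
   represented by (x, false), and s u x is the side of sg on which the edge ux
   leaves u. *)
Definition cut_compatible p q : bool :=
  [&& (p.1 \in sg) || ~~ p.2,
      (p.1 \in sg) && (q.1 \in sg) ==> (p.2 == q.2)
    & (p.1 \in sg) && (q.1 \notin sg) ==> (p.2 == s p.1 q.1)].

(** Adjoining [sg] to [K] fills in both copies of the missing face: compatibility forces a set over
    [sg] to lie in a single copy. *)
Definition cut_complex : {set {set T * bool}} :=
  [set H : {set T * bool} |
    [forall p in H, forall q in H, cut_compatible p q] &&
    (fst @: H \in sg |: K)].

(** For [x] off [sg], the only vertex over [y] that can share a face with [(x, false)]. *)
Definition cut_lift x y : T * bool := (y, (y \in sg) && s y x).
Definition cut_side_lift b y : T * bool := (y, (y \in sg) && b).

Lemma cut_complexP H :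
  reflect ({in H &, forall p q, cut_compatible p q} /\ fst @: H \in sg |: K)
          (H \in cut_complex).
Proof.
rewrite [H \in cut_complex]inE; apply: (iffP andP) => -[cH HK]; split=> //.
  by move=> p q pH qH; move/forall_inP: cH => /(_ p pH)/forall_inP; apply.
by apply/forall_inP=> p pH; apply/forall_inP=> q; apply: cH.
Qed.

Lemma cut_lift_inj x : injective (cut_lift x).
Proof. by move=> y z []. Qed.

Lemma cut_side_lift_inj b : injective (cut_side_lift b).
Proof. by move=> y z []. Qed.

Lemma fst_cut_lift x F : fst @: (cut_lift x @: F) = F.
Proof. by rewrite -imset_comp (eq_imset (g := id)) ?imset_id. Qed.

Lemma fst_cut_side_lift b F : fst @: (cut_side_lift b @: F) = F.
Proof. by rewrite -imset_comp (eq_imset (g := id)) ?imset_id. Qed.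

Lemma compatible_inj H :
  {in H &, forall p q, cut_compatible p q} -> {in H &, injective fst}.
Proof.
move=> cH [x b] [y c] pH qH /= e; subst y; congr (_, _).
have /and3P[/= p1 p2 _] := cH _ _ pH qH; have /and3P[/= q1 _ _] := cH _ _ qH qH.
by move: p1 p2 q1; case: (x \in sg) => /= [_ /eqP//|/negPf-> _ /negPf->].
Qed.

Lemma compatible_lift p x :
  x \notin sg -> cut_compatible p (x, false) -> p = cut_lift x p.1.
Proof.
case: p => y b xsg /and3P[/= p1 _]; rewrite xsg andbT /cut_lift /=.
by case: (y \in sg) p1 => /= [_ /eqP->|/negPf->].
Qed.

(** One vertex off [sg] decides the copies of all vertices of a face, so such a face is determined
    by its projection. *)
Lemma compatible_lift_set H x :
  {in H &, forall p q, cut_compatible p q} -> x \in fst @: H -> x \notin sg ->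
  H = cut_lift x @: (fst @: H).
Proof.
move=> cH /imsetP[[y b] xH /= e] xsg; subst y.
have eb : b = false.
  by have /and3P[/= + _ _] := cH _ _ xH xH; rewrite (negPf xsg); case: b {xH}.
rewrite {}eb in xH; rewrite -imset_comp -[LHS]imset_id; apply: eq_in_imset => p pH /=.
by apply: compatible_lift => //; apply: cH.
Qed.

Hypotheses (d_ge4 : 4 <= d) (cK : simplicial_complex K)
  (linkK : {in vertices K, forall v, stacked_sphere d.-1 (link K [set v])})
  (card_sg : #|sg| = d) (hollow_sg : hollow K sg).

Lemma filled_complex : simplicial_complex (sg |: K).
Proof.
case: cK => K0 dK; split; first by rewrite setU1r.
move=> F G /setU1P[->|FK] sGF; last by rewrite setU1r // (dK F).
have [->|nG] := eqVneq G sg; first exact: setU11.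
by rewrite setU1r //; case: hollow_sg => _; apply; rewrite properEneq nG.
Qed.

Lemma cut_complex_complex : simplicial_complex cut_complex.
Proof.
have [K0 dK] := filled_complex; split.
  by apply/cut_complexP; rewrite imset0; split=> // p q; rewrite inE.
move=> H H' /cut_complexP[cH HK] sH; apply/cut_complexP; split; last first.
  by apply: dK HK _; apply: imsetS.
by move=> p q /(subsetP sH) pH /(subsetP sH); apply: cH.
Qed.

(** Compatibility concerns pairs, and these are proper subsets of [M]; so [M] fails to be a face
    only through its projection. Proper subsets of the projection lift to proper subsets of [M], and
    having fewer than [d] elements they differ from [sg]. *)
Lemma cut_hollow M :
  2 < #|M| <= d -> hollow cut_complex M ->
  [/\ {in M &, forall p q, cut_compatible p q}, #|fst @: M| = #|M|,
      hollow K (fst @: M) & fst @: M != sg].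
Proof.
move=> /andP[M3 Md] [nM hM].
have cM : {in M &, forall p q, cut_compatible p q}.
  move=> p q pM qM; have /hM/cut_complexP[h _] : [set p; q] \proper M.
    rewrite properEcard subUset !sub1set pM qM /=.
    by apply: leq_ltn_trans M3; rewrite cards2; case: (p != q).
  by apply: h; rewrite !inE eqxx ?orbT.
have fI := compatible_inj cM.
have nMK : fst @: M \notin sg |: K.
  by apply: contra nM => MK; apply/cut_complexP.
have cfM : #|fst @: M| = #|M| by rewrite card_in_imset.
split=> //; last by apply: contraNneq nMK => ->; rewrite setU11.
split; first by apply: contra nMK; apply: setU1r.
move=> G pG; have eG : G = fst @: [set p in M | p.1 \in G].
  apply/setP=> x; apply/idP/imsetP=> [xG|[p]]; last by rewrite inE => /andP[_ pG'] ->.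
  have /imsetP[p pM e] := subsetP (proper_sub pG) _ xG.
  by exists p; rewrite // inE pM -e.
have /hM/cut_complexP[_] : [set p in M | p.1 \in G] \proper M.
  rewrite properE; apply/andP; split; first by apply/subsetP=> p;
    rewrite inE => /andP[].
  apply: contraTN pG => sM; rewrite properE negb_and negbK; apply/orP; right.
  by rewrite eG; apply: imsetS.
rewrite -eG => /setU1P[eGs|//].
by have := proper_card pG; rewrite eGs card_sg cfM ltnNge Md.
Qed.

Variable S : T -> bool -> {set {set T}}.
Hypotheses (sidesS : {in sg, forall u, sides_at d K sg (S u) u})
  (signE : forall u x, s u x = (x \in vertices (S u true)))
  (agreeS : {in sg &, forall u u' x, x \notin sg -> [set u; u'; x] \in K ->
     (x \in vertices (S u true)) = (x \in vertices (S u' true))}).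

(** This is where the consistent orientation pays off: by [agreeS] all vertices of [G] in [sg] see
    [x] on the same side, and by [side_vertex_link] each of them sees all of [G] off [sg] on one
    side. *)
Lemma lift_face G x : G \in K -> x \in G -> x \notin sg ->
  cut_lift x @: G \in cut_complex.
Proof.
move=> GK xG xsg; have [_ dK] := cK.
apply/cut_complexP; split; last by rewrite fst_cut_lift setU1r.
move=> _ _ /imsetP[y yG ->] /imsetP[z zG ->]; rewrite /cut_compatible /=.
case: (boolP (y \in sg)) => //= ysg; case: (boolP (z \in sg)) => //= zsg.
  rewrite andbT !signE; apply/eqP; apply: agreeS => //.
  by apply: dK GK _; rewrite !subUset !sub1set yG zG.
rewrite !signE; apply/eqP; apply: (side_vertex_link d_ge4 ysg (sidesS ysg)) => //.
by apply: dK GK _; rewrite !subUset !sub1set yG xG.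
Qed.

Lemma side_lift_face F b : F \subset sg -> cut_side_lift b @: F \in cut_complex.
Proof.
move=> sF; apply/cut_complexP; split.
  move=> _ _ /imsetP[y yF ->] /imsetP[z zF ->]; rewrite /cut_compatible /=.
  by rewrite !(subsetP sF) //= eqxx.
rewrite fst_cut_side_lift; have [_ d'] := filled_complex.
by apply: d' sF; rewrite setU11.
Qed.

Lemma cut_face_lift G : G \in K -> exists2 H, H \in cut_complex & fst @: H = G.
Proof.
move=> GK; case: (boolP (G \subset sg)) => [sG|/subsetPn[x xG xsg]].
  by exists (cut_side_lift false @: G); rewrite ?side_lift_face ?fst_cut_side_lift.
by exists (cut_lift x @: G); rewrite ?lift_face ?fst_cut_lift.
Qed.

Lemma cut_link_outside x : x \notin sg ->
  link cut_complex [set (x, false)] =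
  [set cut_lift x @: F | F : {set T} in link K [set x]].
Proof.
move=> xsg; have ex : cut_lift x x = (x, false) by rewrite /cut_lift (negPf xsg).
apply/setP=> H; rewrite in_link1; apply/andP/imsetP=> [[xH]|[F + ->]]; last first.
  rewrite in_link1 => /andP[xF FK]; split; last first.
    by rewrite -ex -imsetU1 lift_face // setU11.
  by rewrite -ex mem_imset //; apply: cut_lift_inj.
case/cut_complexP=> cH HK.
have eH : H = cut_lift x @: (fst @: H).
  rewrite -imset_comp -[LHS]imset_id; apply: eq_in_imset => p pH /=.
  by apply: compatible_lift => //; apply: cH; rewrite ?setU11 ?setU1r.
exists (fst @: H) => //; rewrite in_link1; apply/andP; split.
  by apply: contra xH => xH; rewrite eH -ex imset_f.
move: HK; rewrite imsetU1 /= => /setU1P[e|//].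
by case/negP: xsg; rewrite -e setU11.
Qed.

(** Splitting [u] distributes the two summands of its link over the two copies; the filled-in copy
    of [sg] supplies the simplex [sg :\ u] that completes each of them. *)
Lemma cut_link_inside u b : u \in sg ->
  link cut_complex [set (u, b)] =
  [set cut_side_lift b @: F | F : {set T} in S u b].
Proof.
move=> usg; have eu : cut_side_lift b u = (u, b) by rewrite /cut_side_lift usg.
have hS := sidesS usg; have cS := side_complex d_ge4 hS b; have [_ dK] := cK.
apply/setP=> H; rewrite in_link1; apply/andP/imsetP=> [[uH]|[F FS ->]]; last first.
  have uF : u \notin F.
    by apply: contra (center_notin_side hS b) => uF; apply: face_vertex cS FS uF.
  split; first by rewrite -eu mem_imset //; apply: cut_side_lift_inj.
  rewrite -eu -imsetU1; case: (boolP (F \subset sg)) => [sF|nsF].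
    by apply: side_lift_face; rewrite subUset sub1set usg.
  have := side_face hS FS nsF; rewrite in_link1 => /andP[_ FK].
  apply/cut_complexP; split; last by rewrite fst_cut_side_lift setU1r.
  move=> _ _ /imsetP[y yF ->] /imsetP[z zF ->]; rewrite /cut_compatible /=.
  case: (boolP (y \in sg)) => //= ysg; case: (boolP (z \in sg)) => //= zsg.
    by rewrite eqxx.
  have zF' : z \in F.
    by move: zF; case/setU1P=> // ezu; move: zsg; rewrite ezu usg.
  have zb : (z \in vertices (S u true)) = b.
    by apply: (side_vertexE hS) => //; apply: face_vertex cS FS zF'.
  rewrite signE -(agreeS usg ysg zsg) ?zb //.
  by apply: dK FK _; rewrite !subUset !sub1set setU11 yF.
case/cut_complexP=> cH HK.
have compH p : p \in H -> p = cut_side_lift b p.1 /\ (p.1 \notin sg -> s u p.1 = b).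
  move=> pH; have /and3P[] := cH p (u, b) (setU1r _ pH) (setU11 _ _).
  have /and3P[_ _ /=] := cH (u, b) p (setU11 _ _) (setU1r _ pH).
  rewrite usg; case: p {pH} => y c; rewrite /cut_side_lift /= andbT.
  by case: (y \in sg) => /= [_ _ /eqP-> _|/eqP-> /negPf-> _ _].
have eH : H = cut_side_lift b @: (fst @: H).
  rewrite -imset_comp -[LHS]imset_id; apply: eq_in_imset => p pH /=.
  by case: (compH p pH).
exists (fst @: H) => //.
case: (boolP (fst @: H \subset sg)) => [sH|/subsetPn[x xH xsg]].
  case: (hS) => _ /(_ b) MS _ _; have [_ dS] := cS; apply: dS MS _.
  rewrite subsetD1 sH; apply: contra uH => uH; by rewrite eH -eu imset_f.
have HL : fst @: H \in link K [set u].
  rewrite in_link1; apply/andP; split.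
    by apply: contra uH => uH; rewrite eH -eu imset_f.
  move: HK; rewrite imsetU1 /= => /setU1P[e|//].
  by case/negP: xsg; rewrite -e setU1r.
(* The projection lies in some side [b']; a vertex [x] of it off [sg] identifies that side as
   [b]. *)
have [b' HS'] := link_side hS HL.
suff -> : b = b' by [].
have <- : s u x = b by case/imsetP: xH xsg => p pH -> psg;
  case: (compH p pH) => _; apply.
rewrite signE; apply: (side_vertexE hS) => //.
exact: face_vertex (side_complex d_ge4 hS b') HS' xH.
Qed.

Lemma cut_vertexP p : p \in vertices cut_complex ->
  p.1 \in vertices K /\ ((p.1 \notin sg) ==> ~~ p.2).
Proof.
rewrite [p \in _]in_vertices => /cut_complexP[cp]; rewrite imset_set1.
have /and3P[p1 _ _] := cp p p (set11 _) (set11 _).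
move=> /setU1P[psg|pK]; last first.
  by rewrite in_vertices; split=> //; rewrite implyNb.
split; last by rewrite implyNb.
by move: d_ge4; rewrite -card_sg -psg cards1.
Qed.

Lemma cut_links_stacked :
  {in vertices cut_complex, forall p, stacked_sphere d.-1 (link cut_complex [set p])}.
Proof.
have d1 : 1 < d.-1 by case: d d_ge4 => [|[|[|[|]]]].
move=> [x b] /cut_vertexP[/= xK]; case: (boolP (x \in sg)) => /= [xsg _|xsg /negPf->].
  rewrite cut_link_inside //; apply: stacked_map => //; first by case: (sidesS xsg).
  by move=> y z _ _; apply: cut_side_lift_inj.
rewrite cut_link_outside //; apply: stacked_map => //; first exact: linkK.
by move=> y z _ _; apply: cut_lift_inj.
Qed.

End Cut.

(** * Complexes whose vertex links are cross-polytopes *)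

(** The invariant of the induction. Connectedness is kept apart because a cut may disconnect the
    complex. *)
Definition locally_stacked (d : nat) (K : colored_complex d) : Prop :=
  [/\ simplicial_complex (faces K), balanced K,
      {in vertices (faces K), forall v,
         stacked_sphere d.-1 (link (faces K) [set v])}
    & forall M : {set vert K}, #|M| = d.-1 -> ~ hollow (faces K) M].

Lemma connect_invariant (T : finType) (e : rel T) (P : pred T) x y :
  (forall a b, P a -> e a b -> P b) -> P x -> connect e x y -> P y.
Proof.
move=> eP + /connectP[p + ->]; elim: p x => //= a p IH x Px /andP[xa].
by apply: IH; apply: eP Px xa.
Qed.

Lemma card_balanced d (K : colored_complex d) F :
  balanced K -> F \in faces K -> #|F| <= d.
Proof.
move=> bK FK; rewrite -(card_in_imset (bK F FK)).
by apply: leq_trans (max_card _) _; rewrite card_ord.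
Qed.

Lemma balanced_facet d (K : colored_complex d) F :
  balanced K -> F \in faces K -> #|F| = d -> facet (faces K) F.
Proof.
move=> bK FK cF; apply/maxsetP; split=> // G GK sFG.
by apply/esym/eqP; rewrite eqEcard sFG cF card_balanced.
Qed.

Lemma color_face_neq d (K : colored_complex d) x y :
  balanced K -> [set x; y] \in faces K -> x != y -> color x != color y.
Proof.
move=> bK xyK; apply: contra_neq => e.
by apply: (bK _ xyK); rewrite ?set21 ?set22.
Qed.

Section CrossPolytope.
Variables (d : nat) (D : colored_complex d).
Hypotheses (d_ge4 : 4 <= d) (lsD : locally_stacked D)
  (connD : connected_complex (faces D))
  (nohollow : forall M : {set vert D}, #|M| = d -> ~ hollow (faces D) M).
Notation K := (faces D).
Implicit Types (x y u v w : vert D) (F G M : {set vert D}) (i : 'I_d).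

Let d1 : 1 < d.-1. Proof. by case: d d_ge4 => [|[|[|[|]]]]. Qed.
Let dS : d.-1.+1 = d. Proof. by case: d d_ge4. Qed.

Definition nbrs v := vertices (link K [set v]).
Definition nbrs_of_color v i := [set x in nbrs v | color x == i].

Lemma in_nbrs v x : (x \in nbrs v) = (x != v) && ([set v; x] \in K).
Proof. exact: in_vertices_link. Qed.

Lemma nbrs_sym v x : (x \in nbrs v) = (v \in nbrs x).
Proof. by rewrite !in_nbrs eq_sym setUC. Qed.

Lemma nbrs_color v x : x \in nbrs v -> color x != color v.
Proof.
case: lsD => _ bK _ _; rewrite in_nbrs => /andP[nx xK].
by rewrite eq_sym; apply: color_face_neq xK _ => //; rewrite eq_sym.
Qed.

(** If [M] were a missing facet of the link, its boundary would lie in [K], so [M] would be a face,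
    there being no missing face of that size. Then [v |: M] would be a missing face with [d]
    vertices, which is excluded. *)
Lemma link_is_cross v : v \in vertices K -> exists X a,
  [/\ antipodal X a, #|X| = d.-1.*2 & link K [set v] = cross_complex X a].
Proof.
case: lsD => -[_ dK] _ linkK noM vK; apply: stacked_flag_cross => //;
  first exact: linkK.
move=> M cM [nM hM].
have vL G : G \proper M -> v \notin G /\ v |: G \in K.
  by move=> /hM; rewrite in_link1 => /andP[].
have pset1 x : x \in M -> [set x] \proper M.
  by move=> xM; rewrite properEcard sub1set xM cards1 cM.
have vM : v \notin M.
  by apply/negP=> vM; have [] := vL _ (pset1 v vM); rewrite inE eqxx.
have pK G : G \proper M -> G \in K.
  by move=> /vL[_ GK]; apply: dK GK _; apply: subsetUr.
have MK : M \in K by apply/negPn/negP=> nMK; apply: (noM M cM).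
apply: (nohollow (M := v |: M)); first by rewrite cardsU1 vM cM.
split; first by apply: contra nM => vMK; rewrite in_link1 vM.
move=> G; rewrite properE => /andP[sG nG].
have [vG|vG] := boolP (v \in G); last first.
  apply: dK MK _; apply/subsetP=> x xG; have /setU1P[exv|//] := subsetP sG _ xG.
  by move: vG; rewrite -exv xG.
have sGM : G :\ v \subset M by rewrite subDset.
have /vL[_] : G :\ v \proper M.
  rewrite properE sGM; apply: contra nG => sMG.
  by rewrite -(setD1K vG) setUS.
by rewrite setD1K.
Qed.

(** Antipodal vertices of the link have equal colours: a facet through [v] and [x] shows all [d]
    colours and remains properly coloured when [x] is exchanged for [a x]. So the antipodal pairs
    are the colour classes of the link. *)
Lemma link_by_color v : v \in vertices K ->
  (forall F, F \subset nbrs v -> {in F &, injective (color (c := D))} ->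
     v |: F \in K) /\
  (forall i, i != color v -> #|nbrs_of_color v i| = 2).
Proof.
case: lsD => _ bK linkK _ vK; have [X [a [aX cX eL]]] := link_is_cross vK.
have sL := linkK v vK.
have eN : nbrs v = X by rewrite /nbrs eL vertices_cross.
have vX : v \notin X by rewrite -eN in_nbrs eqxx.
have full F : F \in link K [set v] -> #|F| = d.-1 ->
    forall i, exists2 y, y \in v |: F & color y = i.
  rewrite in_link1 => /andP[vF FK] cF i.
  have /setP/(_ i) : color (c := D) @: (v |: F) = setT.
    apply/eqP; rewrite eqEcard subsetT cardsT card_ord (card_in_imset (bK _ FK)).
    by rewrite cardsU1 vF cF add1n dS leqnn.
  by rewrite inE => /imsetP[y yF ->]; exists y.
have ca x : x \in X -> color (a x) = color x.
  move=> xX; have [axX nax _] := aX x xX.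
  have xL : [set x] \in link K [set v] by rewrite -in_vertices -/(nbrs v) eN.
  have [F [FL sF cF]] := stacked_pure d1 sL xL.
  have xF : x \in F by rewrite -sub1set.
  have [y yF e] := full F FL cF (color (a x)).
  rewrite eL in FL; have aF := cross_swap aX FL xF.
  have : a x |: F :\ x \in link K [set v] by rewrite eL.
  rewrite in_link1 => /andP[_ aFK].
  have [eyx|nyx] := eqVneq y x; first by rewrite -e eyx.
  have eay : a x = y.
    apply: (bK _ aFK) => //; first by rewrite setU1r ?setU11.
    by move: yF; rewrite !inE nyx => /orP[->|->]; rewrite ?orbT.
  case/cross_complexP: FL => _ /(_ x xF); rewrite eay.
  case/setU1P: yF => [eyv|->//]; by case/negP: vX; rewrite -eyv -eay.
split=> [F sF cF|i nic].
  have : F \in link K [set v].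
    rewrite eL; apply/cross_complexP; rewrite -eN; split=> // x xF.
    have xX : x \in X by rewrite -eN (subsetP sF).
    have [_ nax _] := aX x xX; apply: contra nax => axF.
    by apply/eqP; apply: cF => //; apply: ca.
  by rewrite in_link1 => /andP[].
have L0 : set0 \in link K [set v] by rewrite eL; case: (cross_complex_complex X a).
have [F [FL _ cF]] := stacked_pure d1 sL L0.
have [x xF ex] := full F FL cF i.
have xX : x \in X.
  have /cross_complexP[sF _] : F \in cross_complex X a by rewrite -eL.
  by case/setU1P: xF => [exv|/(subsetP sF)//]; rewrite -ex exv eqxx in nic.
have [axX nax aax] := aX x xX.
suff -> : nbrs_of_color v i = [set x; a x] by rewrite cards2 eq_sym nax.
apply/setP=> y; rewrite inE eN; apply/andP/set2P => [[yX /eqP ey]|[]->]; last 2 first.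
- by rewrite ex.
- by rewrite ca // ex.
have [->|nyx] := eqVneq y x; [by left|right].
apply/eqP; apply: contraT => nya.
have : [set x; y] \in link K [set v].
  rewrite eL; apply/cross_complexP; split; first by rewrite subUset !sub1set xX.
  have [_ nay aay] := aX y yX.
  move=> z /set2P[]->; rewrite !inE; apply/norP; split=> //; first by rewrite eq_sym.
  by apply: contra_neq nya => <-.
rewrite in_link1 => /andP[_ xyK].
by case/eqP: nyx; apply: (bK _ xyK); rewrite ?ey // !inE eqxx ?orbT.
Qed.

Lemma nbrs_vertex v x : x \in nbrs v -> x \in vertices K.
Proof.
case: lsD => cK _ _ _; rewrite in_nbrs => /andP[_ xK].
by apply: face_vertex cK xK _; rewrite set22.
Qed.

(** Neighbours of [v] with different colours are adjacent, which gives one inclusion; both sets have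
    two elements. *)
Lemma nbrs_of_color_adj v u i : u \in nbrs v -> i != color u -> i != color v ->
  nbrs_of_color u i = nbrs_of_color v i.
Proof.
case: (lsD) => cK bK _ _ uv iu iv.
have uK := nbrs_vertex uv; have vK : v \in vertices K.
  by apply: (@nbrs_vertex u); rewrite -nbrs_sym.
have [fv cv] := link_by_color vK; have [_ cu] := link_by_color uK.
apply/esym/eqP; rewrite eqEcard cv // cu // leqnn andbT.
apply/subsetP=> y; rewrite inE => /andP[yv /eqP ey].
rewrite inE ey eqxx andbT.
have nyu : y != u by apply: contra_neq iu => <-.
have /fv xyK : [set u; y] \subset nbrs v by rewrite subUset !sub1set uv yv.
rewrite in_nbrs nyu; case: cK => _ dK; apply: dK (xyK _) (subsetUr _ _).
have cuy : color u != color y by rewrite ey eq_sym.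
by move=> a b /set2P[]-> /set2P[]-> // e; move: cuy; rewrite e eqxx.
Qed.

Lemma nbrs_of_color_exists v i : v \in vertices K -> i != color v ->
  exists2 x, x \in nbrs v & color x = i.
Proof.
move=> /link_by_color[_ cv] /cv c2.
have /card_gt0P[x] : 0 < #|nbrs_of_color v i| by rewrite c2.
by rewrite inE => /andP[xv /eqP]; exists x.
Qed.

Lemma third_color (i j : 'I_d) : exists l, l \notin [set i; j].
Proof.
have /subsetPn[l _ nl] : ~~ ([set: 'I_d] \subset [set i; j]).
  apply/negP=> /subset_leq_card; rewrite cardsT card_ord cards2 leqNgt.
  by rewrite (leq_trans _ d_ge4) //; case: (i != j).
by exists l.
Qed.

(** The pair [C i] is read off from [v0], except for the colour of [v0] itself, where a neighbour
    [u0] is used. The union of the pairs is closed under adjacency, so by connectedness it contains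
    every vertex. *)
Lemma color_classes v0 : v0 \in vertices K -> exists C : 'I_d -> {set vert D},
  [/\ forall i, #|C i| = 2, forall i, {in C i, forall x, color x = i},
      vertices K = [set x | x \in C (color x)]
    & forall x i, x \in vertices K -> i != color x -> nbrs_of_color x i = C i].
Proof.
move=> v0K; set c0 := color v0.
have [l] := third_color c0 c0; rewrite !inE orbb => lc0.
have [u0 u0N eu0] := nbrs_of_color_exists v0K lc0.
(* Two neighbours of [v0] with different colours are adjacent; those of equal colour are compared
   through a neighbour of a third colour. *)
have indep u : u \in nbrs v0 -> nbrs_of_color u c0 = nbrs_of_color u0 c0.
  have step w w' : w \in nbrs v0 -> w' \in nbrs v0 -> color w' != color w ->
      nbrs_of_color w c0 = nbrs_of_color w' c0.
    move=> wN w'N nww'; apply: nbrs_of_color_adj; rewrite 1?eq_sym ?nbrs_color //.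
    have : w \in nbrs_of_color v0 (color w) by rewrite inE wN eqxx.
    rewrite -(nbrs_of_color_adj w'N); first by rewrite inE => /andP[].
      by rewrite eq_sym.
    exact: nbrs_color.
  move=> uN; have [m] := third_color c0 (color u);
    rewrite !inE negb_or => /andP[mc0 mu].
  have [w wN ew] := nbrs_of_color_exists v0K mc0.
  have [eu|nu] := eqVneq (color u0) (color u); last exact: step.
  rewrite (step u w) ?ew //; apply: step => //; rewrite ew.
  by rewrite eu eq_sym.
pose C i := if i == c0 then nbrs_of_color u0 c0 else nbrs_of_color v0 i.
have cC i : #|C i| = 2.
  rewrite /C; case: eqVneq => [_|ni].
    have [_ ->//] := link_by_color (nbrs_vertex u0N).
    by rewrite eq_sym nbrs_color.
  by have [_ ->] := link_by_color v0K.
have colC i : {in C i, forall x, color x = i}.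
  by move=> x; rewrite /C; case: eqVneq => [->|_]; rewrite inE => /andP[_ /eqP].
have v0C : v0 \in C c0 by rewrite /C eqxx inE -nbrs_sym u0N eqxx.
have NC x i : x \in C (color x) -> i != color x -> nbrs_of_color x i = C i.
  have [->|nxv0] := eqVneq x v0.
    by move=> _ ni; rewrite /C (negPf ni).
  rewrite {1}/C; case: eqVneq => [ex|nx] xC ni; last first.
    have xN : x \in nbrs v0 by move: xC; rewrite inE => /andP[].
    rewrite /C; case: eqVneq => [->|nic]; first exact: indep.
    exact: nbrs_of_color_adj.
  (* [x] has the colour of [v0]. A common neighbour [u] of a third colour carries the colour class
     [i] from [v0] to [x]. *)
  have [m] := third_color c0 i; rewrite !inE negb_or => /andP[mc0 mi].
  have [u uN eu] := nbrs_of_color_exists v0K mc0.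
  have xu : x \in nbrs u by move: xC; rewrite -(indep u uN) inE => /andP[].
  rewrite ex in ni; rewrite /C (negPf ni).
  rewrite (nbrs_of_color_adj xu) ?ex // ?eu 1?eq_sym // -?(eq_sym m).
  by apply: nbrs_of_color_adj => //; rewrite eu eq_sym.
have closedC x y : x \in C (color x) -> adjacent K x y -> y \in C (color y).
  move=> xC /= /andP[nxy xyK].
  have yN : y \in nbrs x by rewrite in_nbrs eq_sym nxy.
  rewrite -(NC x) ?nbrs_color //; by rewrite inE yN eqxx.
have VC : vertices K = [set x | x \in C (color x)].
  apply/setP=> x; rewrite [RHS]inE; apply/idP/idP => [xK|xC].
    have c0x := connD v0K xK.
    by apply: (connect_invariant (P := fun x => x \in C (color x)) closedC v0C c0x).
  move: xC; rewrite /C; case: eqVneq => _; rewrite inE => /andP[xN _];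
    exact: nbrs_vertex xN.
exists C; split=> // x i; rewrite VC inE; exact: NC.
Qed.

Lemma flag_locally_stacked_Walkup v0 : v0 \in vertices K -> balanced_Walkup D.
Proof.
case: (lsD) => cK bK _ _ v0K.
have [C [cC colC VC NC]] := color_classes v0K.
have [f fC] : exists f : 'I_d -> vert D * vert D,
    forall i, (f i).1 != (f i).2 /\ C i = [set (f i).1; (f i).2].
  apply: (fin_all_exists (P := fun i p => p.1 != p.2 /\ C i = [set p.1; p.2])) => i.
  have /cards2P[x [y [nxy e]]] : #|C i| == 2 by rewrite cC.
  by exists (x, y).
pose g (p : 'I_d * bool) := if p.2 then (f p.1).1 else (f p.1).2.
have gC p : g p \in C p.1.
  by rewrite /g; have [_ ->] := fC p.1; case: p.2; rewrite !inE eqxx ?orbT.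
have gcol p : color (g p) = p.1 by apply: colC (gC p).
have gI : injective g.
  move=> [i b] [j c] e; have eij : i = j by rewrite -[i](gcol (i, b)) e gcol.
  subst j; congr (_, _); move: e; rewrite /g /=; have [/eqP nf _] := fC i.
  by case: b; case: c => // e; case: nf.
have gsurj x : x \in vertices K -> exists p, x = g p.
  rewrite VC inE; have [_ ->] := fC (color x); case/set2P=> ->.
    by exists (color x, true).
  by exists (color x, false).
apply: Walkup_iso (Walkup_cross d) _; exists g; split; last by [].
  by move=> p q _ _; apply: gI.
apply/setP=> F; apply/idP/imsetP => [FK|[H HX ->]].
  exists [set p | g p \in F].
    rewrite inE; apply/forallP=> i; rewrite !inE; apply/negP=> /andP[tF fF].
    by have := bK F FK _ _ tF fF; rewrite !gcol => /(_ erefl) /gI.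
  apply/setP=> x; apply/idP/imsetP => [xF|[p]]; last by rewrite inE => pF ->.
  have [p ep] := gsurj x (face_vertex cK FK xF).
  by exists p; rewrite // inE -ep.
have [->|/set0Pn[p pH]] := eqVneq H set0; first by rewrite imset0; case: cK.
have gpK : g p \in vertices K by rewrite VC inE gcol.
have [fv _] := link_by_color gpK.
have colI : {in H &, injective fst}.
  move=> [i b] [j c] pH' qH /= e; subst j; congr (_, _).
  move: HX; rewrite inE => /forallP/(_ i); move: pH' qH.
  by case: b; case: c => // -> ->.
have pF : g p \in g @: H by apply: imset_f.
rewrite -(setD1K pF); apply: fv.
  apply/subsetP=> z /setD1P[nqp /imsetP[q qH e]]; rewrite e.
  have : g q \in nbrs_of_color (g p) q.1.
    rewrite NC //; rewrite gcol; apply: contra_neq nqp => eqp.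
    by rewrite e (colI q p).
  by rewrite inE => /andP[].
move=> _ _ /setD1P[_ /imsetP[q qH ->]] /setD1P[_ /imsetP[r rH ->]].
by rewrite !gcol => /(colI _ _ qH rH)->.
Qed.

End CrossPolytope.

(** * Undoing the cut *)

Lemma connect_adjacent_sym (T : finType) (K : {set {set T}}) :
  connect_sym (adjacent K).
Proof. by apply: sym_connect_sym => x y; rewrite /adjacent /= eq_sym setUC. Qed.

Section Component.
Variables (T : finType) (K : {set {set T}}) (v : T).
Hypotheses (cK : simplicial_complex K).
Implicit Types (F G M : {set T}) (x y : T).

Definition component : {set {set T}} :=
  [set F in K | [forall x in F, connect (adjacent K) v x]].

Lemma componentP F :
  reflect (F \in K /\ {in F, forall x, connect (adjacent K) v x})
          (F \in component).
Proof.
rewrite inE; apply: (iffP andP) => -[FK cF]; split=> //; first exact/forall_inP.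
exact/forall_inP.
Qed.

Lemma connect_face F x y : F \in K -> x \in F -> y \in F -> connect (adjacent K) x y.
Proof.
move=> FK xF yF; have [->|nxy] := eqVneq x y; first exact: connect0.
apply: connect1; rewrite /adjacent /= nxy; case: cK => _ dK; apply: dK FK _.
by rewrite subUset !sub1set xF.
Qed.

Lemma in_component F x :
  F \in K -> x \in F -> connect (adjacent K) v x -> F \in component.
Proof.
move=> FK xF vx; apply/componentP; split=> // y yF.
by apply: connect_trans vx _; apply: connect_face FK xF yF.
Qed.

Lemma component_complex : simplicial_complex component.
Proof.
case: cK => K0 dK; split; first by apply/componentP; split=> // x; rewrite inE.
move=> F G /componentP[FK cF] sG; apply/componentP; split; first exact: dK FK sG.
by move=> x /(subsetP sG)/cF.
Qed.

Lemma vertices_component x :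
  (x \in vertices component) = (x \in vertices K) && connect (adjacent K) v x.
Proof.
rewrite !in_vertices; apply/componentP/andP => -[xK cx]; split=> //.
  by apply: cx; rewrite inE.
by move=> y /set1P->.
Qed.

Lemma link_component x : x \in vertices component ->
  link component [set x] = link K [set x].
Proof.
rewrite vertices_component => /andP[_ vx]; apply/setP=> G; rewrite !in_link1.
case: (x \notin G) => //=; apply/idP/idP => [/componentP[]//|GK].
by apply: in_component GK (setU11 _ _) vx.
Qed.

(** A singleton inside [M] is a proper subset, so it connects [M] to [v]; if [M] were a face of [K]
    it would belong to the component. *)
Lemma hollow_component M : 1 < #|M| -> hollow component M -> hollow K M.
Proof.
move=> M2 [nM hM]; split; last by move=> G /hM/componentP[].
have /card_gt0P[x xM] : 0 < #|M| by apply: ltnW.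
apply: contra nM => MK; apply: (in_component MK xM).
have /hM/componentP[_] : [set x] \proper M by rewrite properEcard sub1set xM cards1.
by apply; rewrite inE.
Qed.

Lemma component_connected : connected_complex component.
Proof.
have vcomp x : x \in vertices component -> connect (adjacent component) v x.
  rewrite vertices_component => /andP[_ vx].
  suff /andP[] : connect (adjacent K) v x && connect (adjacent component) v x by [].
  apply: (connect_invariant (P := fun x => connect (adjacent K) v x &&
    connect (adjacent component) v x) _ _ vx); last by rewrite !connect0.
  move=> a b /andP[va va'] /= /andP[nab abK]; apply/andP; split.
    by apply: (connect_trans va); apply: connect1; rewrite /adjacent /= nab.
  apply: (connect_trans va'); apply: connect1; rewrite /adjacent /= nab.
  exact: in_component abK (set21 _ _) va.
move=> x y /vcomp vx /vcomp; apply: connect_trans.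
by rewrite connect_adjacent_sym.
Qed.

End Component.

Definition hollows (T : finType) (K : {set {set T}}) (d : nat) : {set {set T}} :=
  [set M : {set T} | [&& #|M| == d, M \notin K
    & [forall G : {set T}, (G \proper M) ==> (G \in K)]]].

Lemma hollowsP (T : finType) (K : {set {set T}}) d (M : {set T}) :
  reflect (#|M| = d /\ hollow K M) (M \in hollows K d).
Proof.
rewrite inE; apply: (iffP and3P) => [[/eqP cM nM /forallP hM]|[cM [nM hM]]].
  by split=> //; split=> // G pG; move/implyP: (hM G); apply.
split=> //; first exact/eqP.
by apply/forallP=> G; apply/implyP; apply: hM.
Qed.

Definition component_of d (K : colored_complex d) (v : vert K) : colored_complex d :=
  ColoredComplex (component (faces K) v) (color (c := K)).

Lemma component_locally_stacked d (K : colored_complex d) (v : vert K) :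
  2 < d -> locally_stacked K -> locally_stacked (component_of v).
Proof.
move=> d2 [cK bK linkK noM]; split.
- exact: component_complex.
- by move=> F /componentP[FK _]; apply: bK.
- move=> x xV; rewrite /= link_component //; apply: linkK.
  by move: xV; rewrite /= vertices_component => /andP[].
- move=> M cM /= hM; apply: (noM M cM).
  by apply: hollow_component hM => //; rewrite cM ltn_predRL.
Qed.

Lemma hollows_component d (T : finType) (K : {set {set T}}) v :
  1 < d -> simplicial_complex K -> hollows (component K v) d \subset hollows K d.
Proof.
move=> d1 cK; apply/subsetP=> M /hollowsP[cM hM]; apply/hollowsP; split=> //.
by apply: hollow_component hM => //; rewrite cM.
Qed.

(** * The coloured cut complex and the recovery of the original complex *)

Section CutColored.
Variables (d : nat) (D : colored_complex d) (sg : {set vert D})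
  (S : vert D -> bool -> {set {set vert D}}).
Notation K := (faces D).
Notation T := (vert D).
Hypotheses (d_ge4 : 4 <= d) (lsD : locally_stacked D)
  (connD : connected_complex K) (card_sg : #|sg| = d) (hollow_sg : hollow K sg)
  (sidesS : {in sg, forall u, sides_at d K sg (S u) u})
  (agreeS : {in sg &, forall u u' x, x \notin sg -> [set u; u'; x] \in K ->
     (x \in vertices (S u true)) = (x \in vertices (S u' true))}).

Let s u x := x \in vertices (S u true).
Let signE u x : s u x = (x \in vertices (S u true)) := erefl.

Definition cut_colored : colored_complex d :=
  @ColoredComplex d (T * bool)%type (cut_complex K sg s) (fun p => color p.1).
Notation K' := (cut_complex K sg s).

Let cK : simplicial_complex K. Proof. by case: lsD. Qed.
Let bK : balanced D. Proof. by case: lsD. Qed.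
Let cK' : simplicial_complex K'. Proof. exact: cut_complex_complex. Qed.

(** [sg] is not a face, but its pairs are; this keeps the complex balanced after filling. *)
Lemma sg_color_inj : {in sg &, injective (color (c := D))}.
Proof.
move=> x y xsg ysg; have /bK h : [set x; y] \in K.
  case: hollow_sg => _; apply; rewrite properEcard subUset !sub1set xsg ysg card_sg.
  by apply: leq_trans d_ge4; rewrite cards2; case: (x != y).
by apply: h; rewrite ?set21 ?set22.
Qed.

Lemma cut_locally_stacked : locally_stacked cut_colored.
Proof.
case: lsD => _ _ linkK noM; split=> //=.
- move=> H /cut_complexP[cH HK] p q pH qH /= e; apply: (compatible_inj cH) => //.
  have pF : p.1 \in fst @: H by apply: imset_f.
  have qF : q.1 \in fst @: H by apply: imset_f.
  case/setU1P: HK => [eH|HK]; last exact: bK HK _ _ pF qF e.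
  by rewrite eH in pF qF; apply: sg_color_inj.
- exact: (cut_links_stacked d_ge4 cK linkK card_sg hollow_sg sidesS signE agreeS).
- move=> M cM hM; have [|_ cM' hM' _] := cut_hollow card_sg _ hM.
    by rewrite cM; case: d d_ge4 => [|[|[|[|n]]]] //= _; rewrite leqnSn.
  by apply: (noM (fst @: M)); rewrite // cM'.
Qed.

(** Projection maps the missing faces of the cut complex into those of [K] other than [sg]. It is
    injective on them because a projection different from [sg] has a vertex off [sg], which
    determines the lift. *)
Lemma cut_fewer_hollows : #|hollows K' d| < #|hollows K d|.
Proof.
have sgH : sg \in hollows K d by apply/hollowsP.
have hcut M : M \in hollows K' d ->
    [/\ {in M &, forall p q, cut_compatible sg s p q}, #|fst @: M| = d,
      hollow K (fst @: M) & fst @: M != sg].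
  case/hollowsP=> cM hM; rewrite -[X in _ = X]cM; apply: cut_hollow hM => //.
  by rewrite cM card_sg leqnn (leq_trans _ d_ge4).
rewrite [X in _ < X](cardsD1 sg) sgH add1n ltnS.
rewrite -(card_in_imset (f := fun M : {set T * bool} => fst @: M)).
  apply/subset_leq_card/subsetP=> _ /imsetP[M /hcut[_ cM hM nM] ->].
  by rewrite in_setD1 nM; apply/hollowsP.
move=> M M' /hcut[cM cardM _ nM] /hcut[cM' _ _ _] /= e.
have /subsetPn[x xM xsg] : ~~ (fst @: M \subset sg).
  by apply: contra nM => sM; rewrite eqEcard sM cardM card_sg leqnn.
rewrite (compatible_lift_set cM xM xsg) e; apply/esym.
by apply: compatible_lift_set => //; rewrite -e.
Qed.

(** The two filled-in copies of [sg]; identifying them along [push] and deleting the result undoes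
    the cut. *)
Let upper := cut_side_lift sg true @: sg.
Let lower := cut_side_lift sg false @: sg.
Let push (p : T * bool) : T * bool := (p.1, false).

Lemma in_upper p : (p \in upper) = (p.1 \in sg) && p.2.
Proof.
apply/imsetP/andP => [[u usg ->]|[]]; first by rewrite /cut_side_lift /= usg.
by case: p => x [] //= xsg _; exists x; rewrite // /cut_side_lift xsg.
Qed.

Lemma in_lower p : (p \in lower) = (p.1 \in sg) && ~~ p.2.
Proof.
apply/imsetP/andP => [[u usg ->]|[]]; first by rewrite /cut_side_lift /= usg.
by case: p => x [] //= xsg _; exists x; rewrite // /cut_side_lift xsg.
Qed.

Lemma upper_face : upper \in K'.
Proof. exact: side_lift_face. Qed.

Lemma lower_face : lower \in K'.
Proof. exact: side_lift_face. Qed.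

Lemma card_upper : #|upper| = d.
Proof. by rewrite card_imset //; apply: cut_side_lift_inj. Qed.

Lemma card_lower : #|lower| = d.
Proof. by rewrite card_imset //; apply: cut_side_lift_inj. Qed.

Lemma push_upper : push @: upper = lower.
Proof.
rewrite -imset_comp; apply: eq_in_imset => u usg.
by rewrite /push /cut_side_lift /= andbF.
Qed.

Lemma push_imset (H : {set T * bool}) :
  push @: H = cut_side_lift sg false @: (fst @: H).
Proof.
by rewrite -imset_comp; apply: eq_imset => p; rewrite /= /cut_side_lift andbF.
Qed.

Lemma upper_disjoint_lower : [disjoint upper & lower].
Proof.
apply/pred0P=> p /=; rewrite in_upper in_lower.
by case: (p.1 \in sg); case: p.2.
Qed.

Lemma push_inj_upper : {in upper &, injective push}.
Proof.
move=> [x b] [y c]; rewrite !in_upper /= => /andP[_ bt] /andP[_ ct] [->].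
by rewrite bt ct.
Qed.

Lemma cut_vertex p : p \in vertices K' -> (p.1 \notin sg) ==> ~~ p.2.
Proof. by case/(cut_vertexP d_ge4 card_sg). Qed.

Lemma face_not_sg G : G \in K -> G != sg.
Proof. by apply: contraTneq => ->; case: hollow_sg. Qed.

(** A neighbour of a copy of [u] determines that copy, by its own copy if it lies over [sg] and by
    its side otherwise. *)
Lemma upper_lower_no_common_neighbor p q : p \in upper ->
  ~ (adjacent K' p q /\ adjacent K' (push p) q).
Proof.
case: p q => u b [y c]; rewrite in_upper /= => /andP[usg bt] [].
rewrite {}bt /push /= => /andP[n1 /cut_complexP[c1 _]] /andP[n2 /cut_complexP[c2 _]].
have /and3P[/= _ a1 a2] := c1 _ _ (set21 _ _) (set22 _ _).
have /and3P[/= _ b1 b2] := c2 _ _ (set21 _ _) (set22 _ _).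
move: a1 a2 b1 b2; rewrite usg /=; case: (y \in sg) => /=.
  by move=> /eqP<- _ /eqP.
by move=> _ /eqP<- _ /eqP.
Qed.

(** The isomorphism is [fst]: after the identification every vertex has second component [false],
    and the only faces over [sg] have become the deleted one. *)
Lemma handle_case : balanced_Walkup cut_colored -> balanced_Walkup D.
Proof.
have [_ bK' _ _] := cut_locally_stacked.
move=> WD; have /(Walkup_handle WD) W : facet (faces cut_colored) upper.
  exact: (balanced_facet bK' upper_face card_upper).
have {}W := W lower push (balanced_facet bK' lower_face card_lower) upper_disjoint_lower.
apply: Walkup_iso (W _ _) _; first split=> //=.
- exact: push_inj_upper.
- exact: push_upper.
- exact: upper_lower_no_common_neighbor.
pose q (p : T * bool) := if p \in upper then push p else p.
have qE p : p \in vertices K' -> q p = push p.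
  move=> /cut_vertex; rewrite /q in_upper; case: p => x b /=.
  by case: (x \in sg); case: b.
have fq (H : {set T * bool}) : fst @: (q @: H) = fst @: H.
  by rewrite -imset_comp; apply: eq_imset => p /=; rewrite /q; case: ifP.
have qH (H : {set T * bool}) : H \in K' -> q @: H = push @: H.
  by move=> HK; apply: eq_in_imset => p pH; apply: qE; apply: face_vertex cK' HK pH.
exists fst; split=> //=.
- move=> p p';
  rewrite !in_vertices => /setD1P[_ /imsetP[H HK e]] /setD1P[_ /imsetP[H' HK' e']].
  have : p \in q @: H by rewrite -e set11.
  have : p' \in q @: H' by rewrite -e' set11.
  by rewrite !qH // => /imsetP[r _ ->] /imsetP[r' _ ->] /= er; rewrite /push er.
- rewrite push_upper; apply/setP=> G;
  apply/idP/imsetP => [GK|[Z /setD1P[nZ /imsetP[H HK eZ]] ->]].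
    have [H HK eG] := cut_face_lift d_ge4 cK hollow_sg sidesS signE agreeS GK.
    exists (q @: H); last by rewrite fq.
    rewrite in_setD1 imset_f // andbT; apply: contraNneq (face_not_sg GK) => eH.
    by rewrite -eG -fq eH fst_cut_side_lift.
  rewrite eZ fq; have /cut_complexP[_ /setU1P[eH|//]] := HK.
  by case/eqP: nZ; rewrite eZ -/(q @: H) qH // push_imset eH.
Qed.

(** A path of [K] from [u0] is followed in the cut complex. Whenever it visits [sg] the lift may
    change copies, but each copy of [sg] is a face containing a copy of [u0]. Hence there are at
    most two components. *)
Lemma cut_connected_to u0 p : u0 \in sg -> p \in vertices K' ->
  exists c, connect (adjacent K') (u0, c) p.
Proof.
move=> u0sg pV; have [p1K _] := cut_vertexP d_ge4 card_sg pV.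
have inside y c : y \in sg -> connect (adjacent K') (u0, c) (y, c).
  move=> ysg; have sub : [set u0; y] \subset sg by rewrite subUset !sub1set u0sg.
  have FK := side_lift_face s cK hollow_sg c sub.
  apply: (connect_face cK' FK); apply/imsetP.
    by exists u0; rewrite ?set21 // /cut_side_lift u0sg.
  by exists y; rewrite ?set22 // /cut_side_lift ysg.
pose P x := [exists c, connect (adjacent K') (u0, c) (x, false)].
suff Pp : (p.1 \in sg) || P p.1.
  case: p pV p1K Pp => x b /cut_vertex /= xb _ Pp.
  case: (boolP (x \in sg)) xb Pp => [xsg _ _|xsg /= /negPf-> /existsP//].
  by exists b; apply: inside.
have u0V : u0 \in vertices K by apply: (sg_vertex d_ge4 card_sg hollow_sg).
apply: (connect_invariant (P := fun x => (x \in sg) || P x) _ _ (connD u0V p1K));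
  last by rewrite u0sg.
move=> a b aP /= /andP[nab abK]; case: (boolP (b \in sg)) => //= bsg.
have FK := lift_face d_ge4 cK sidesS signE agreeS abK (set22 a b) bsg.
have eb : cut_lift sg s b b = (b, false) by rewrite /cut_lift (negPf bsg).
have step : connect (adjacent K') (cut_lift sg s b a) (b, false).
  by apply: (connect_face cK' FK); rewrite -?eb imset_f ?set21 ?set22.
apply/existsP; case: (boolP (a \in sg)) aP => [asg _|asg /= /existsP[c ac]].
  exists (s a b); apply: connect_trans step.
  by rewrite /cut_lift asg; apply: inside.
exists c; apply: connect_trans ac _.
by move: step; rewrite /cut_lift (negPf asg).
Qed.

Lemma connected_cut_case u0 : u0 \in sg ->
  connect (adjacent K') (u0, true) (u0, false) -> connected_complex K'.
Proof.
move=> u0sg c0 p q pV qV.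
have base r : r \in vertices K' -> connect (adjacent K') (u0, true) r.
  case/(cut_connected_to u0sg) => -[] //; exact: connect_trans c0.
by apply: (connect_trans _ (base q qV)); rewrite connect_adjacent_sym base.
Qed.

(** The component of [(u0, b)] contains exactly the copy [b] of [sg], so the two components are
    summed along [upper] and [lower]; forgetting the copy gives the isomorphism with [D]. *)
Lemma sum_case u0 : u0 \in sg ->
  ~~ connect (adjacent K') (u0, true) (u0, false) ->
  (forall b, balanced_Walkup (component_of (K := cut_colored) (u0, b))) ->
  balanced_Walkup D.
Proof.
move=> u0sg nc WC.
pose E b := component_of (K := cut_colored) (u0, b).
have d2 : 2 < d by apply: leq_trans d_ge4.
have bE b : balanced (E b).
  by case: (component_locally_stacked (K :=
    cut_colored) (u0, b) d2 cut_locally_stacked).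
have inside u c : u \in sg -> connect (adjacent K') (u0, c) (u, c).
  move=> usg; have sub : sg \subset sg by [].
  have FK := side_lift_face s cK hollow_sg c sub.
  apply: (connect_face cK' FK); apply/imsetP.
    by exists u0; rewrite // /cut_side_lift u0sg.
  by exists u; rewrite // /cut_side_lift usg.
have sep p : connect (adjacent K') (u0, true) p ->
  connect (adjacent K') (u0, false) p -> False.
  move=> c1 c2; case/negP: nc; apply: connect_trans c1 _.
  by rewrite connect_adjacent_sym.
have sgnE b p : p \in vertices (faces (E b)) -> p.1 \in sg -> p.2 = b.
  rewrite vertices_component => /andP[_ cp] psg; case: p cp psg => x c /= cp xsg.
  have := inside x c xsg; case: b c cp => -[] // c1 c2; first by case: (sep _ c1 c2).
  by case: (sep _ c2 c1).
have cE b : simplicial_complex (faces (E b)) by apply: component_complex.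
have upE : upper \in faces (E true).
  have u0up : (u0, true) \in upper by rewrite in_upper u0sg.
  exact: (in_component cK' upper_face u0up (connect0 _ _)).
have loE : lower \in faces (E false).
  have u0lo : (u0, false) \in lower by rewrite in_lower u0sg.
  exact: (in_component cK' lower_face u0lo (connect0 _ _)).
have fU : facet (faces (E true)) upper by apply: balanced_facet => //;
  exact: card_upper.
have fL : facet (faces (E false)) lower by apply: balanced_facet => //;
  exact: card_lower.
have cb : color_bijection (K := E true) (L := E false) upper lower push.
  by split; [exact: push_inj_upper|exact: push_upper|].
apply: Walkup_iso (Walkup_sum (WC true) (WC false) fU fL cb) _.
pose h (z : (T * bool) + (T * bool)) : T :=
  match z with inl p => p.1 | inr p => p.1 end.
pose gl := glue_inl (K := E true) (L := E false) upper push.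
have hgl (H : {set T * bool}) : h @: (gl @: H) = fst @: H.
  by rewrite -imset_comp; apply: eq_imset => p /=; rewrite /gl /glue_inl; case: ifP.
have hinr (H : {set T * bool}) : h @: (inr @: H) = fst @: H.
  by rewrite -imset_comp; apply: eq_imset.
have K'E (H : {set T * bool}) b : H \in faces (E b) -> H \in K'.
  by case/componentP.
(* Vertices that remain on the left lie off [sg], since those of [upper] have been renamed to
   right-hand ones. *)
have vE z : z \in vertices (faces (connected_sum (K := E true) (L :=
  E false) upper push)) ->
    (exists2 p, z = inl p & p \in vertices (faces (E true)) /\ p.1 \notin sg) \/
    (exists2 p, z = inr p & p \in vertices (faces (E false))).
  rewrite in_vertices connected_sum_faces => /setD1P[_ /setUP[]] /imsetP[H HE ez].
    have : z \in gl @: H by rewrite -ez set11.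
    case/imsetP=> p pH ->; have pV := face_vertex (cE true) HE pH.
    rewrite /gl /glue_inl; case: (boolP (p \in upper)) => [pu|pu].
      right; exists (push p) => //; apply: face_vertex (cE false) loE _.
      by rewrite -push_upper imset_f.
    left; exists p => //; split=> //; apply: contra pu => psg.
    by rewrite in_upper psg (sgnE true).
  have : z \in inr @: H by rewrite -ez set11.
  case/imsetP=> p pH ->; right; exists p => //; exact: face_vertex (cE false) HE pH.
have outE b p : p \in vertices (faces (E b)) -> p.1 \notin sg -> p = (p.1, false).
  rewrite vertices_component => /andP[/cut_vertex + _]; case: p => x c /= + xsg.
  by rewrite xsg /= => /negPf->.
(* Off [sg] a vertex has a single lift, so equal projections would put one vertex in both
   components. *)
have sepE p q : p \in vertices (faces (E true)) -> q \in vertices (faces (E false)) ->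
    p.1 \notin sg -> p.1 = q.1 -> False.
  move=> pV qV psg e; have qsg : q.1 \notin sg by rewrite -e.
  have epq : p = q by rewrite (outE _ _ pV psg) (outE _ _ qV qsg) e.
  move: pV qV; rewrite -epq !vertices_component => /andP[_ c1] /andP[_ c2].
  exact: sep c1 c2.
(* The only face of a component over [sg] is its filled-in copy, which the connected sum deletes. *)
have fullE b (H : {set T * bool}) : H \in faces (E b) -> fst @: H = sg ->
    H = cut_side_lift sg b @: sg.
  move=> HE eH; transitivity (cut_side_lift sg b @: (fst @: H)); last by rewrite eH.
  rewrite -imset_comp -[LHS]imset_id; apply: eq_in_imset => p pH /=.
  have psg : p.1 \in sg by rewrite -eH imset_f.
  rewrite /cut_side_lift psg -(sgnE _ _ (face_vertex (cE b) HE pH) psg).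
  exact: surjective_pairing.
exists h; split.
- move=> z z' /vE[[p -> [pV psg]]|[p -> pV]] /vE[[q -> [qV qsg]]|[q -> qV]] /= e.
  + by rewrite (outE _ _ pV psg) (outE _ _ qV qsg) e.
  + by case: (sepE p q pV qV psg e).
  + by case: (sepE q p qV pV qsg (esym e)).
  + congr inr; have [psg|psg] := boolP (p.1 \in sg).
      have qsg : q.1 \in sg by rewrite -e.
      rewrite [p]surjective_pairing [q]surjective_pairing e.
      by rewrite (sgnE _ _ pV psg) (sgnE _ _ qV qsg).
    have qsg : q.1 \notin sg by rewrite -e.
    by rewrite (outE _ _ pV psg) (outE _ _ qV qsg) e.
- rewrite connected_sum_faces push_upper.
  apply/setP=> G; apply/idP/imsetP => [GK|[Z /setD1P[nZ /setUP[]/imsetP[H HE eZ]] ->]].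
  + have [H HK eG] := cut_face_lift d_ge4 cK hollow_sg sidesS signE agreeS GK.
    have nsg := face_not_sg GK.
    have [b HE] : exists b, H \in faces (E b).
      have [->|/set0Pn[p pH]] := eqVneq H set0; first by exists true; case: (cE true).
      have [b pc] := cut_connected_to u0sg (face_vertex cK' HK pH).
      by exists b; apply: (in_component cK' HK pH).
    case: b HE => HE.
      exists (gl @: H); last by rewrite hgl.
      rewrite in_setD1 in_setU imset_f // andbT; apply: contraNneq nsg => e.
      by rewrite -eG -hgl e hinr fst_cut_side_lift.
    exists (inr @: H); last by rewrite hinr.
    rewrite in_setD1 in_setU imset_f ?orbT // andbT; apply: contraNneq nsg => e.
    by rewrite -eG -hinr e hinr fst_cut_side_lift.
  + rewrite eZ hgl; have /cut_complexP[_ /setU1P[eH|//]] := K'E _ _ HE.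
    case/eqP: nZ; rewrite eZ -push_upper.
    rewrite (fullE true H HE eH).
    rewrite -[RHS]imset_comp; apply: eq_in_imset => p pu.
    by rewrite /gl /glue_inl pu.
  + rewrite eZ hinr; have /cut_complexP[_ /setU1P[eH|//]] := K'E _ _ HE.
    by case/eqP: nZ; rewrite eZ (fullE false H HE eH).
- by case.
Qed.

End CutColored.

(** The vertex [v0] excludes the complex whose only face is empty, which is connected and locally
    stacked vacuously. *)
Lemma locally_stacked_Walkup d (D : colored_complex d) v0 :
  4 <= d -> locally_stacked D -> connected_complex (faces D) ->
  v0 \in vertices (faces D) -> balanced_Walkup D.
Proof.
move=> d_ge4; have [n] := ubnP #|hollows (faces D) d|.
elim: n => // n IHn in D v0 * => ltn lsD connD v0V.
have [h0|/set0Pn[sg /hollowsP[csg hsg]]] := eqVneq (hollows (faces D) d) set0.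
  apply: (flag_locally_stacked_Walkup d_ge4 lsD connD _ v0V) => M cM hM.
  by have : M \in hollows (faces D) d by [apply/hollowsP]; rewrite h0 inE.
have [cK bK linkK _] := lsD.
have [S [sidesS agreeS]] := consistent_sides d_ge4 cK linkK csg hsg.
have ls' := cut_locally_stacked d_ge4 lsD csg hsg sidesS agreeS.
have fewer := cut_fewer_hollows S d_ge4 csg hsg.
have /card_gt0P[u0 u0sg] : 0 < #|sg| by rewrite csg (leq_trans _ d_ge4).
have vV b : (u0, b) \in vertices (faces (cut_colored sg S)).
  have [cK' _ _ _] := ls'.
  have := side_lift_face (fun u x => x \in vertices (S u true)) cK hsg b (subxx sg).
  move/(face_vertex cK'); apply; apply/imsetP; exists u0 => //.
  by rewrite /cut_side_lift u0sg.
have ltn' : #|hollows (faces (cut_colored sg S)) d| < n by apply: leq_trans fewer _.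
have [c0|nc0] :=
  boolP (connect (adjacent (faces (cut_colored sg S))) (u0, true) (u0, false)).
  apply: (handle_case d_ge4 lsD csg hsg sidesS agreeS).
  apply: (IHn (cut_colored sg S) (u0, true)) => //.
  exact: (connected_cut_case d_ge4 lsD connD csg hsg sidesS agreeS u0sg c0).
apply: (sum_case d_ge4 lsD connD csg hsg sidesS agreeS u0sg nc0) => b.
have [cK' _ _ _] := ls'.
apply: (IHn (component_of (K := cut_colored sg S) (u0, b)) (u0, b)).
- apply: leq_ltn_trans ltn'; apply: subset_leq_card.
  by apply: hollows_component => //; apply: leq_trans d_ge4.
- by apply: component_locally_stacked => //; apply: leq_trans d_ge4.
- exact: component_connected.
- by rewrite vertices_component vV connect0.
Qed.

Theorem theorem4p11 (d : nat) (Delta : colored_complex d)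
  (hd : 4 <= d)
  (hcomplex : simplicial_complex (faces Delta))
  (hbalanced : balanced Delta)
  (hnormal : normal_pseudomanifold d (faces Delta))
  (hlinks : forall v : vert Delta, v \in vertices (faces Delta) ->
     stacked_cross_polytopal_sphere d.-1 (link (faces Delta) [set v]))
  (hmissing : forall M : {set vert Delta},
     missing_face (faces Delta) M -> #|M| <> d.-1) :
  balanced_Walkup Delta.
Proof.
have d1 : 1 < d.-1 by rewrite ltn_predRL (leq_trans _ hd).
have [v0 v0V] : exists v0, v0 \in vertices (faces Delta).
  have [F mF _] := maxset_exists (P := [in faces Delta]) hcomplex.1.
  case: hnormal => _ /(_ F mF) cF _ _.
  have /card_gt0P[v vF] : 0 < #|F| by rewrite cF (leq_trans _ hd).
  by exists v; apply: face_vertex hcomplex _ vF; case/maxsetP: mF.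
case: hnormal => conn _ _ _; apply: (locally_stacked_Walkup hd _ conn v0V).
split=> // [v /hlinks[c sc]|M cM [nM hM]].
  exact: (stacked_colored_sphere d1 sc).
apply: (hmissing M _ cM); split=> //; apply/subsetP=> x xM; rewrite in_vertices.
by apply: hM; rewrite properEcard sub1set xM cards1 cM.
Qed.
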